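(* Let $\mu$ be an infinite, translation invariant and semi scale invariant measure on $(\mathfrak{G},\mathcal{F})$, where $\mathfrak{G}$ is the collection of subsets of $\mathbb{R}^d$ of diameter strictly smaller than $1$. Assume that: (1) for every bounded $A\subset\mathbb{R}^d$ and every $\delta>0$, $\mu(\{G\in\mathfrak{G}: G\cap A\neq\emptyset,\ \mathrm{diam}(G)\geq\delta\})<\infty$; (2) $\mu(\{G\in\mathfrak{G}:\mathcal{L}(\partial G)>0\})=0$; (3) $\mu(\{G\in\mathfrak{G}:\mathcal{L}(G)>0\})>0$. Then the critical value $\lambda_e=\inf\{\lambda>0:\mathbb{P}(\mathcal{C}(\lambda)=\emptyset)=1\}$ satisfies $$\lambda_e=\frac{d\log 2}{\mu(\mathcal{A}_1)},$$ where $\mathcal{A}_1=\{G\in\mathfrak{G}: o\in G,\ 2^{-1}\leq\mathrm{diam}(G)<1\}$.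
   Context: $\mathcal{L}$ is Lebesgue measure on $\mathbb{R}^d$, $\partial G$ is the topological boundary of $G$, $o$ is the origin. $\mathfrak{G}=\{G\subset\mathbb{R}^d:\mathrm{diam}(G)<1\}$ is equipped with a suitable $\sigma$-algebra $\mathcal{F}$ (one for which all the subsets of $\mathfrak{G}$, functions and events considered are measurable). Translation invariance of $\mu$: $\mu(x+\mathcal{D})=\mu(\mathcal{D})$ for all $\mathcal{D}\in\mathcal{F}$, $x\in\mathbb{R}^d$, where $x+\mathcal{D}=\{L\subset\mathbb{R}^d: L=x+G\text{ for some }G\in\mathcal{D}\}$. Semi scale invariance of $\mu$: whenever $\mathcal{D}\in\mathcal{F}$ has $\mu(\mathcal{D})<\infty$ and $0<s<\infty$ is such that $\mathcal{D}_s:=\{G\subset\mathbb{R}^d: G/s\in\mathcal{D}\}$ contains only sets of diameter strictly smaller than $1$, then $\mu(\mathcal{D}_s)=\mu(\mathcal{D})$. For $0<\lambda<\infty$, $\Phi_\lambda(\mu)$ is a Poisson process on $\mathfrak{G}$ with intensity measure $\lambda\mu$, and the random fractal is $\mathcal{C}(\lambda)=\mathbb{R}^d\setminus\bigcup_{G\in\Phi_\lambda(\mu)}G$. *)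

(* Defs.v *)
From HB Require Import structures.
From mathcomp Require Import all_boot all_order all_algebra.
From mathcomp Require Import all_classical all_reals all_analysis.
From mathcomp Require Import measurable_realfun.

Set Implicit Arguments.
Unset Strict Implicit.
Unset Printing Implicit Defensive.

Import Order.TTheory GRing.Theory Num.Theory.
Import numFieldNormedType.Exports.

Local Open Scope classical_set_scope.
Local Open Scope ring_scope.

Section geometry.
Variables (R : realType) (d : nat).
Implicit Types A G : set 'rV[R]_d.

(* The library norm on ['rV[R]_d] is the sup norm; diameters are Euclidean. *)
Definition euclid_norm (x : 'rV[R]_d) : R :=
  Num.sqrt (\sum_(i < d) x 0 i ^+ 2).

(* Adding 0 to the set of distances makes the diameter of the empty set 0. *)
Definition diam A : \bar R :=
  ereal_sup ([set 0%E] `|`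
    [set r | exists x y, [/\ A x, A y & r = (euclid_norm (x - y))%:E]]).

Definition boundary A : set 'rV[R]_d := closure A `\` interior A.

Definition box (a b : 'rV[R]_d) : set 'rV[R]_d :=
  [set x | forall i, a 0 i <= x 0 i <= b 0 i].

Definition box_volume (a b : 'rV[R]_d) : R :=
  \prod_(i < d) Num.max 0 (b 0 i - a 0 i).

(* Lebesgue outer measure: it agrees with Lebesgue measure on the Lebesgue
   measurable sets, and is defined for every set. *)
Definition lebesgue_Rd A : \bar R :=
  ereal_inf [set v | exists a b : nat -> 'rV[R]_d,
    A `<=` \bigcup_k box (a k) (b k) /\
    v = (\sum_(0 <= k <oo) (box_volume (a k) (b k))%:E)%E].

End geometry.

Definition small_set (R : realType) (d : nat) : Type :=
  {G : set 'rV[R]_d | (diam G < 1)%E}.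

Definition shape (R : realType) (d : nat) (G : small_set R d) :
  set 'rV[R]_d := sval G.

Lemma diam_set0 (R : realType) (d : nat) : diam (set0 : set 'rV[R]_d) = 0%E.
Proof.
rewrite /diam; have -> : [set 0%E] `|` [set r | exists x y : 'rV[R]_d,
    [/\ set0 x, set0 y & r = (euclid_norm (x - y))%:E]] = [set 0%E].
  by rewrite predeqE => r; split=> [[//|[x [y []]]]|]; [|left].
exact: ereal_sup1.
Qed.

HB.instance Definition _ (R : realType) (d : nat) :=
  Choice.on (small_set R d).

Lemma diam_set0_lt1 (R : realType) (d : nat) :
  (diam (set0 : set 'rV[R]_d) < 1)%E.
Proof. by rewrite diam_set0 lte01. Qed.

HB.instance Definition _ (R : realType) (d : nat) :=
  isPointed.Build (small_set R d) (exist _ set0 (@diam_set0_lt1 R d)).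

Section families.
Variables (R : realType) (d : nat).
Local Notation GG := (small_set R d).
Implicit Types (F : set (set GG)) (D : set GG) (A : set 'rV[R]_d).

Definition translate (x : 'rV[R]_d) D : set GG :=
  [set L | exists2 G, D G & shape L = [set x + y | y in shape G]].

(* The sets [G] of the whole space with [G / s] in [D]; their diameters need
   not be [< 1]. *)
Definition dilate (s : R) D : set (set 'rV[R]_d) :=
  [set G | exists2 H, D H & shape H = [set s^-1 *: y | y in G]].

Definition dilate_small (s : R) D : Prop :=
  dilate s D `<=` [set G | (diam G < 1)%E].

Definition hitting A (delta : R) : set GG :=
  [set G | shape G `&` A !=set0 /\ (delta%:E <= diam (shape G))%E].

Definition containing A (delta : R) : set GG :=
  [set G | A `<=` shape G /\ (delta%:E <= diam (shape G))%E].

Definition fat_boundary : set GG :=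
  [set G | (0 < lebesgue_Rd (boundary (shape G)))%E].

Definition fat : set GG := [set G | (0 < lebesgue_Rd (shape G))%E].

Definition calA1 : set GG :=
  [set G | [/\ shape G 0, ((2^-1)%:E <= diam (shape G))%E &
               (diam (shape G) < 1)%E]].

(* A sigma-algebra for which the families of sets at play are measurable.  The
   families [containing A delta] are needed to speak of a set being covered by
   a single member of the process. *)
Record suitable F : Prop := Suitable {
  suitable_sigma_algebra : sigma_algebra setT F ;
  suitable_translate : forall x D, F D -> F (translate x D) ;
  suitable_dilate : forall s D, 0 < s -> dilate_small s D ->
    F D -> F (@shape R d @^-1` dilate s D) ;
  suitable_hitting : forall A delta, bounded_set A -> 0 < delta ->
    F (hitting A delta) ;
  suitable_containing : forall A delta, compact A -> 0 < delta ->
    F (containing A delta) ;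
  suitable_fat_boundary : F fat_boundary ;
  suitable_fat : F fat ;
  suitable_calA1 : F calA1
}.

Definition translation_invariant F (mu : set GG -> \bar R) : Prop :=
  forall x D, F D -> mu (translate x D) = mu D.

Definition semi_scale_invariant F (mu : set GG -> \bar R) : Prop :=
  forall s D, F D -> (mu D < +oo)%E -> 0 < s -> dilate_small s D ->
    mu (@shape R d @^-1` dilate s D) = mu D.

(* A configuration is a countable family of points of [GG], listed with
   multiplicity; the indices mapped to [None] carry no point. *)
Definition configuration : Type := nat -> option GG.

Definition npoints (phi : configuration) D : \bar R :=
  counting [set i | exists2 G, D G & phi i = Some G].

Definition uncovered (phi : configuration) : set 'rV[R]_d :=
  ~` [set x | exists i G, phi i = Some G /\ shape G x].

(* The second argument of [poisson_prob] is a dummy; [poisson_prob 0] is the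
   Dirac mass at 0. *)
Record poisson_process F (nu : set GG -> \bar R) (dO : measure_display)
    (Omega : measurableType dO) (P : probability Omega R)
    (Phi : Omega -> configuration) : Prop := PoissonProcess {
  npoints_measurable : forall D, F D ->
    measurable_fun setT (fun w => npoints (Phi w) D) ;
  npoints_poisson : forall D, F D -> (nu D < +oo)%E -> forall k : nat,
    P [set w | npoints (Phi w) D = k%:R%:E] =
    poisson_prob (fine (nu D)) k [set k] ;
  npoints_infinite : forall D, F D -> nu D = +oo%E ->
    P [set w | npoints (Phi w) D = +oo%E] = 1%E ;
  npoints_independent : forall (n : nat) (D : 'I_n -> set GG)
      (B : 'I_n -> set (\bar R)),
    (forall i, F (D i)) -> trivIset setT D -> (forall i, measurable (B i)) ->
    P (\bigcap_i [set w | B i (npoints (Phi w) (D i))]) =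
    (\prod_(i < n) P [set w | B i (npoints (Phi w) (D i))])%E
}.

(* One probability space for each intensity: only the law of each process
   matters, no coupling is required.
   Extended-real valued, so that the infimum of the empty set is [+oo]. *)
Definition lambda_e (dO : measure_display) (Omega : R -> measurableType dO)
    (P : forall l : R, probability (Omega l) R)
    (Phi : forall l : R, Omega l -> configuration) : \bar R :=
  ereal_inf [set l%:E | l in [set l : R | 0 < l /\
    P l [set w | uncovered (Phi l w) = set0] = 1%E]].

End families.

(* Main.v *)
Require Import Defs.
From mathcomp Require Import all_boot all_order all_algebra.
From mathcomp Require Import all_classical all_reals all_analysis.
From mathcomp Require Import measurable_realfun.
From mathcomp Require Import lra ring zify.

(** The law of the process enters only through vacancy probabilities:
    P(no set of the process lies in D) = exp (- l * mu D).

    Scale invariance splits the sets meeting a cube of side 2^-k r into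
    diameter bands [2^-(k+1), 2^-k) which all carry the same mass.  A null
    boundary has Jordan content 0 on compact sets, so only a vanishing fraction
    of the cells of a fine grid straddle G; averaging over the grid, the mass
    h(r) of the sets of diameter at least 1/2 which hit a cube of radius r and
    the mass c(r) of those which contain it both tend to mu A_1 as r tends to 0.

    If l c(r) > d log 2, the expected number of cubes of side of order 2^-n not
    contained in a single set of the process is at most of order
    2^(dn) exp (- l (n+1) c(r)), which tends to 0.

    If l h(r) < d log 2, call a point x of the grid of mesh 2^-n alive when no
    set of a band k <= n hits the cube of centre x and radius 2^-k r.  The
    normalised number of alive points has mean 1, and an energy which dominates
    its square has bounded mean, so with probability bounded below the alive
    points carry mass at least 1/2 which is spread over all scales.  A cluster
    point of alive points is missed by all sets of positive diameter.  Nothing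
    controls the sets of diameter 0, but there are countably many of them and
    the spread of the mass allows the alive points to stay away from them. *)

Set Implicit Arguments.
Unset Strict Implicit.
Unset Printing Implicit Defensive.

Import Order.TTheory GRing.Theory Num.Theory.
Import numFieldNormedType.Exports.

Local Open Scope classical_set_scope.
Local Open Scope ring_scope.

(* [seq.shape] shadows [Defs.shape]. *)
Local Notation shape := Defs.shape.

(** * Diameters, cubes and similarities *)

Section geometry.
Variables (R : realType) (d : nat).
Implicit Types (c x y : 'rV[R]_d) (A G : set 'rV[R]_d) (r s : R).

Lemma coord_le_euclid x i : `|x 0 i| <= euclid_norm x.
Proof.
rewrite -sqrtr_sqr /euclid_norm ler_wsqrtr// (bigD1 i)//= lerDl.
by apply: sumr_ge0 => j _; exact: sqr_ge0.
Qed.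

Lemma euclid_normZ s x : euclid_norm (s *: x) = `|s| * euclid_norm x.
Proof.
rewrite /euclid_norm -[`|s|]sqrtr_sqr -sqrtrM ?sqr_ge0// mulr_sumr.
by congr Num.sqrt; apply: eq_bigr => i _; rewrite mxE exprMn.
Qed.

Lemma euclid_le_diam A x y : A x -> A y ->
  ((euclid_norm (x - y))%:E <= diam A)%E.
Proof. by move=> Ax Ay; apply: ereal_sup_ubound; right; exists x, y. Qed.

Lemma diam_ge0 A : (0 <= diam A)%E.
Proof. by apply: ereal_sup_ubound; left. Qed.

Lemma diam_le A M : (0 <= M)%E ->
  (forall x y, A x -> A y -> ((euclid_norm (x - y))%:E <= M)%E) ->
  (diam A <= M)%E.
Proof.
by move=> M0 AM; apply: ge_ereal_sup => _ [->//|[x [y [Ax Ay ->]]]]; exact: AM.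
Qed.

Definition sim c s A := [set c + s *: y | y in A].

Lemma simK c s A : s != 0 -> sim (- (s^-1 *: c)) s^-1 (sim c s A) = A.
Proof.
move=> s0; have K y : - (s^-1 *: c) + s^-1 *: (c + s *: y) = y.
  by rewrite scalerDr addKr scalerA mulVf// scale1r.
apply/seteqP; split=> [_ [_ [y Ay <-] <-]|y Ay]; first by rewrite K.
by exists (c + s *: y); [exists y|rewrite K].
Qed.

Lemma diam_sim c s A : 0 < s -> diam (sim c s A) = (s%:E * diam A)%E.
Proof.
have le c' s' A' : 0 < s' -> (diam (sim c' s' A') <= s'%:E * diam A')%E.
  move=> s'0; apply: diam_le => [|_ _ [x Ax <-] [y Ay <-]].
    by rewrite mule_ge0 ?diam_ge0// lee_fin ltW.
  rewrite opprD addrACA subrr add0r -scalerBr euclid_normZ gtr0_norm// EFinM.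
  by rewrite lee_pmul2l// euclid_le_diam.
move=> s0; apply/eqP; rewrite eq_le le//=.
rewrite -[X in (_ * diam X)%E](@simK c s A) ?gt_eqF//.
rewrite -[X in (_ <= X)%E]mul1e -(divff (lt0r_neq0 s0)) EFinM -muleA.
by rewrite lee_pmul2l// le// invr_gt0.
Qed.

Definition cube c r : set 'rV[R]_d := [set x | forall i, `|x 0 i - c 0 i| <= r].

Lemma cube_compact c r : compact (cube c r).
Proof.
have -> : cube c r =
    [set x | forall i, [set t | c 0 i - r <= t <= c 0 i + r] (x 0 i)].
  by apply/seteqP; split=> x /= xc i; move: (xc i); rewrite ler_distl.
apply: (@rV_compact R d (fun i => [set t | c 0 i - r <= t <= c 0 i + r])) => i.
have -> : [set t | c 0 i - r <= t <= c 0 i + r] = `[c 0 i - r, c 0 i + r]%classic.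
  by apply/seteqP; split=> t /=; rewrite in_itv.
exact: segment_compact.
Qed.

Lemma cube_bounded c r : bounded_set (cube c r).
Proof. by apply: compact_bounded; exact: cube_compact. Qed.

Lemma cubexx c r : 0 <= r -> cube c r c.
Proof. by move=> r0 i; rewrite subrr normr0. Qed.

Lemma sub_cube c r s : r <= s -> cube c r `<=` cube c s.
Proof. by move=> rs x xc i; exact: le_trans (xc i) rs. Qed.

Lemma sim_cube c s r x : 0 < s -> cube c (s * r) (c + s *: x) <-> cube 0 r x.
Proof.
move=> s0; suff E i : (`|(c + s *: x) 0 i - c 0 i| <= s * r) =
    (`|x 0 i - (0 : 'rV[R]_d) 0 i| <= r).
  by split=> H i; [rewrite -E|rewrite E].
by rewrite !mxE subr0 addrC addKr normrM gtr0_norm// ler_pM2l.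
Qed.

End geometry.

(** * Dyadic diameter bands and the similarities between them *)

Section families.
Variables (R : realType) (d : nat).
Local Notation GG := (small_set R d).
Implicit Types (D : set GG) (A : set 'rV[R]_d) (c : 'rV[R]_d).

(** The lower end is closed, as in [calA1]; a set of diameter 0 lies in no band. *)
Definition band (k : nat) : set GG :=
  [set G | ((2^-1 ^+ k.+1)%:E <= diam (shape G))%E /\
           (diam (shape G) < (2^-1 ^+ k)%:E)%E].

Definition hit A k : set GG := [set G | shape G `&` A !=set0 /\ band k G].

Definition cont A k : set GG := [set G | A `<=` shape G /\ band k G].

Definition transport c (s : R) D : set GG :=
  [set G | exists2 H, D H & shape G = sim c s (shape H)].

Definition small A (sm : (diam A < 1)%E) : GG := exist _ A sm.

Lemma dilate_sim (s : R) D G : 0 < s ->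
  dilate s D G <-> exists2 H, D H & G = sim 0 s (shape H).
Proof.
move=> s0; split=> -[H DH E]; exists H => //.
  rewrite E /sim; apply/seteqP.
  split=> [x Gx|_ [_ [x Gx <-] <-]].
    exists (s^-1 *: x); first by exists x.
    by rewrite add0r scalerA divff ?gt_eqF// scale1r.
  by rewrite add0r scalerA divff ?gt_eqF// scale1r.
rewrite E /sim; apply/seteqP; split=> [x Hx|_ [_ [x Hx <-] <-]].
  by exists (0 + s *: x); [exists x|rewrite add0r scalerA mulVf ?gt_eqF// scale1r].
by rewrite add0r scalerA mulVf ?gt_eqF// scale1r.
Qed.

Lemma dilate_small_le1 (s : R) D : 0 < s <= 1 -> dilate_small s D.
Proof.
move=> /andP[s0 s1] G /(dilate_sim _ _ s0)[H DH ->] /=.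
rewrite diam_sim//; apply: le_lt_trans (svalP H).
by rewrite -[leRHS]mul1e lee_wpmul2r ?diam_ge0 ?lee_fin.
Qed.

(** Writes a contraction as a dilation followed by a translation, the two operations under which
    [mu] is invariant. As [s <= 1], the intermediate set is again an element of [GG]. *)
Lemma translate_dilate c (s : R) D : 0 < s <= 1 ->
  translate c (@shape R d @^-1` dilate s D) = transport c s D.
Proof.
move=> s01; have s0 : 0 < s by case/andP: s01.
apply/seteqP; split=> [L [G /(dilate_sim _ _ s0)[H DH GE] LE]|L [H DH LE]].
  exists H => //; rewrite LE GE /sim; apply/seteqP.
  split=> [_ [_ [y Hy <-] <-]|_ [y Hy <-]]; first by exists y; rewrite ?add0r.
  by exists (0 + s *: y); [exists y|rewrite add0r].
have sm : (diam (sim 0 s (shape H)) < 1)%E.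
  by apply: (dilate_small_le1 (D := D) s01); apply/(dilate_sim _ _ s0); exists H.
exists (small sm); first by apply/(dilate_sim _ _ s0); exists H.
rewrite LE /= /sim; apply/seteqP.
split=> [_ [y Hy <-]|_ [_ [y Hy <-] <-]]; last by exists y; rewrite ?add0r.
by exists (0 + s *: y); [exists y|rewrite add0r].
Qed.

Lemma exp_half_gt0 k : 0 < (2^-1 : R) ^+ k.
Proof. by rewrite exprn_gt0// invr_gt0. Qed.

Lemma exp_half_le1 k : (2^-1 : R) ^+ k <= 1.
Proof. by rewrite exprn_ile1//; lra. Qed.

Hint Resolve exp_half_gt0 exp_half_le1 : core.

Lemma band0E : band 0 = [set G | ((2^-1)%:E <= diam (shape G))%E].
Proof.
by apply/seteqP; split=> [G [] //|G ?]; split=> //; exact: (svalP G).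
Qed.

Lemma band_transport c k (G H : GG) : shape G = sim c (2^-1 ^+ k) (shape H) ->
  band k G <-> band 0 H.
Proof.
move=> E; rewrite /band /= E diam_sim// expr1 expr0 exprSr EFinM lee_pmul2l//.
by rewrite -[X in (_ < X)%E]mule1 lte_pmul2l.
Qed.

(** The upper end of band [k] is exactly what lets a set be blown up by 2^k and still have diameter
    below 1. *)
Lemma band_inv c k G : band k G ->
  exists H, band 0 H /\ shape G = sim c (2^-1 ^+ k) (shape H).
Proof.
set s := 2^-1 ^+ k => bG; have s0 : 0 < s by exact: exp_half_gt0.
have sm : (diam (sim (- (s^-1 *: c)) s^-1 (shape G)) < 1)%E.
  rewrite diam_sim ?invr_gt0// lte_pdivrMl// mule1.
  by case: bG.
have E : shape G = sim c s (shape (small sm)).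
  rewrite /= -[LHS](@simK _ _ (- (s^-1 *: c)) s^-1) ?invr_eq0 ?gt_eqF//.
  by rewrite !invrK scalerN opprK scalerA divff ?gt_eqF// scale1r.
by exists (small sm); split=> //; apply/(band_transport E).
Qed.

Lemma transport_hit c r k :
  transport c (2^-1 ^+ k) (hit (cube 0 r) 0) = hit (cube c (2^-1 ^+ k * r)) k.
Proof.
apply/seteqP; split=> [G [H [[x [Hx xr]] bH] E]|G [[x [Gx xr]] bG]].
  split; last exact/(band_transport E).
  exists (c + 2^-1 ^+ k *: x); split; first by rewrite E; exists x.
  exact/sim_cube.
have [H [bH E]] := band_inv c bG; exists H => //; split=> //.
move: Gx; rewrite E => -[y Hy yx]; exists y; split=> //.
by apply/(sim_cube c _ _ (exp_half_gt0 k)); rewrite yx.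
Qed.

Lemma transport_cont c r k :
  transport c (2^-1 ^+ k) (cont (cube 0 r) 0) = cont (cube c (2^-1 ^+ k * r)) k.
Proof.
apply/seteqP; split=> [G [H [Hr bH] E]|G [Gr bG]].
  split; last exact/(band_transport E).
  rewrite E => x xr; have xE : x = c + 2^-1 ^+ k *: ((2^-1 ^+ k)^-1 *: (x - c)).
    by rewrite scalerA divff ?gt_eqF// scale1r addrC subrK.
  exists ((2^-1 ^+ k)^-1 *: (x - c)); last by rewrite -xE.
  by apply: Hr; apply/(sim_cube c _ _ (exp_half_gt0 k)); rewrite -xE.
have [H [bH E]] := band_inv c bG; exists H => //; split=> // x xr.
have : sim c (2^-1 ^+ k) (shape H) (c + 2^-1 ^+ k *: x).
  by rewrite -E; apply: Gr; exact/sim_cube.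
case=> y Hy /addrI /(congr1 ( *:%R ((2^-1 ^+ k)^-1))).
by rewrite !scalerA mulVf ?gt_eqF// !scale1r => <-.
Qed.

End families.

(** * Jordan content of null boundaries *)

Section counting.
Variable R : realType.

Lemma sum_interval_le N (u v : R) :
  \sum_(j < N) ((u <= j%:R <= v)%R%:R : R) <= Num.max 0 (v - u + 1).
Proof.
elim: N v => [|N IH] v; first by rewrite big_ord0 le_max lexx.
rewrite big_ord_recr/=; have [/andP[uN Nv]|_] := boolP (u <= N%:R <= v); last first.
  by rewrite addr0; exact: IH.
(* Once index [N] is counted, all earlier indices are at most [N - 1]. The induction hypothesis is
   used with [N - 1] in place of [v], and the unit gained there pays for index [N]. *)
have -> : \sum_(j < N) ((u <= j%:R <= v)%R%:R : R) =
    \sum_(j < N) ((u <= j%:R <= (N%:R - 1 : R))%R%:R : R).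
  apply: eq_bigr => j _; have jN : (j : nat)%:R <= N%:R - 1 :> R.
    by rewrite lerBrDr natr1 ler_nat.
  by rewrite jN (le_trans jN)//; lra.
rewrite le_max; apply/orP; right; rewrite lerD2r.
by apply: le_trans (IH _) _; rewrite ge_max; apply/andP; split; lra.
Qed.

(** The indicator of a box is a product over the coordinates, so the count is at most a product of
    one-dimensional counts. *)
Lemma card_box_le d N (u v : 'I_d -> R) (B : pred {ffun 'I_d -> 'I_N}) :
  (forall q, B q -> forall i, u i <= (q i)%:R <= v i) ->
  #|B|%:R <= \prod_i Num.max 0 (v i - u i + 1).
Proof.
move=> Buv.
apply: (@le_trans _ _ (\prod_(i < d) \sum_(j < N) ((u i <= j%:R <= v i)%R%:R : R))).
  rewrite bigA_distr_bigA -sum1_card natr_sum big_mkcond/=.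
  apply: ler_sum => q _; case: ifPn => [|_]; last by rewrite prodr_ge0.
  move=> /Buv qB; rewrite big1// => i _; by rewrite qB.
apply: ler_prod => i _; rewrite sumr_ge0//=; exact: sum_interval_le.
Qed.

End counting.

Section content.
Variables (R : realType) (d : nat).
Implicit Types (c x y : 'rV[R]_d) (A G : set 'rV[R]_d) (r : R).

Lemma cube_convex c r x y (t : R) : 0 <= t <= 1 -> cube c r x -> cube c r y ->
  cube c r (x + t *: (y - x)).
Proof.
move=> /andP[t0 t1] xc yc i; rewrite !mxE.
have -> : x 0 i + t * (y 0 i - x 0 i) - c 0 i =
  (1 - t) * (x 0 i - c 0 i) + t * (y 0 i - c 0 i) by ring.
have t1' : 0 <= 1 - t by rewrite subr_ge0.
rewrite (le_trans (ler_normD _ _))// !normrM (ger0_norm t0) (ger0_norm t1').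
rewrite [leRHS](_ : _ = (1 - t) * r + t * r); last by ring.
by rewrite lerD// ler_wpM2l.
Qed.

(** If the cube missed the boundary, the closure and the interior of [G] would agree on it. On a
    segment from a point of [G] to a point outside, the trace of [G] would be open, closed and
    nonempty, hence the whole segment. *)
Lemma cube_meets_boundary c r G : cube c r `&` G !=set0 ->
  ~ (cube c r `<=` G) -> cube c r `&` boundary G !=set0.
Proof.
move=> [p [cp Gp]] cG; have [q [cq Gq]] : exists q, cube c r q /\ ~ G q.
  apply: contrapT => nq; apply: cG => q cq; apply: contrapT => Gq.
  by apply: nq; exists q.
apply: contrapT => noB.
have cB x : cube c r x -> closure G x -> interior G x.
  by move=> cx Gx; apply: contrapT => iGx; apply: noB; exists x.
pose f (t : R) : 'rV[R]_d := p + t *: (q - p).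
have fc : continuous f.
  by move=> t; apply: cvgD; [exact: cvg_cst|apply: cvgZr_tmp].
have cf t : `[0, 1]%classic t -> cube c r (f t).
  by rewrite /= in_itv/= => t01; exact: cube_convex.
have B1 : [set t | `[0, 1]%classic t /\ G (f t)] = `[0, 1]%classic.
  apply: (@segment_connected R 0 1).
  - by exists 0; split; rewrite /= ?in_itv/= ?lexx ?ler01// /f scale0r addr0.
  - exists (f @^-1` interior G).
      by apply: open_comp => [? _|]; [exact: fc|exact: open_interior].
    apply/seteqP; split=> t [t01 Gt]; split=> //.
      by apply: cB; [exact: cf|exact: subset_closure].
    exact: (@interior_subset _ G).
  - exists (f @^-1` closure G).
      by apply: closed_comp => [? _|]; [exact: fc|exact: closed_closure].
    apply/seteqP; split=> t [t01 Gt]; split=> //; first exact: subset_closure.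
    by apply: (@interior_subset _ G); apply: cB => //; exact: cf.
have : [set t | `[0, 1]%classic t /\ G (f t)] 1.
  by rewrite B1 /= in_itv/= ler01 lexx.
by rewrite /f /= scale1r addrC subrK => -[].
Qed.

(** Continuity at 0 of the polynomial with factors max(0, l_i) + X, which dominates the product on
    the left. *)
Lemma prod_max_near (l : 'I_d -> R) (e : R) : 0 < e ->
  exists2 s, 0 < s &
    \prod_i Num.max 0 (l i + s) <= \prod_i Num.max 0 (l i) + e.
Proof.
move=> e0; pose p : {poly R} := \prod_i ((Num.max 0 (l i))%:P + 'X).
have pE t : p.[t] = \prod_i (Num.max 0 (l i) + t).
  by rewrite horner_prod; apply: eq_bigr => i _; rewrite !hornerE.
have /cvgrPdist_lt/(_ _ e0)/nbhs_ballP[s /= s0 sb] := @continuous_horner R p 0.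
exists (s / 2); first by rewrite divr_gt0.
have /sb : ball (0 : R) s (s / 2).
  by rewrite /ball/= sub0r normrN ger0_norm; lra.
rewrite /= distrC => /ltr_distlDr/ltW.
have -> : p.[0] = \prod_i Num.max 0 (l i).
  by rewrite pE; apply: eq_bigr => i _; rewrite addr0.
rewrite pE; apply: le_trans; apply: ler_prod => i _; rewrite le_max lexx/=.
rewrite ge_max; apply/andP; split.
  by rewrite addr_ge0 ?le_max ?lexx//; lra.
by rewrite lerD2r le_max lexx orbT.
Qed.

(** Centres of the N^d cells of the unit cube; the cells are the cubes of radius 1/(2N) around
    them. *)
Definition grid N (q : {ffun 'I_d -> 'I_N}) : 'rV[R]_d :=
  \row_i (((q i)%:R + 2^-1) / N%:R).

Definition unit_cube : set 'rV[R]_d := [set x | forall i, 0 <= x 0 i <= 1].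

Lemma unit_cube_compact : compact unit_cube.
Proof.
have -> : unit_cube = cube (\row_i 2^-1) (2^-1).
  apply/seteqP; split=> x /= H i; move: (H i); rewrite mxE ler_distl;
    by move=> /andP[? ?]; apply/andP; split; lra.
exact: cube_compact.
Qed.

Lemma grid_cubeP N (q : {ffun 'I_d -> 'I_N}) x :
  cube (grid q) (2^-1 / N%:R) x <->
  forall i, (q i)%:R <= N%:R * x 0 i <= (q i)%:R + 1.
Proof.
have E i : (`|x 0 i - grid q 0 i| <= 2^-1 / N%:R) =
    ((q i)%:R <= N%:R * x 0 i <= (q i)%:R + 1).
  have N0 : (0 : R) < N%:R by rewrite ltr0n (leq_ltn_trans _ (ltn_ord (q i))).
  rewrite mxE ler_distl -mulrBl -mulrDl ler_pdivrMr// ler_pdivlMr//.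
  by congr (_ && _); rewrite mulrC; congr (_ <= _); lra.
by split=> H i; [rewrite -E|rewrite E].
Qed.

Lemma grid_cube_sub N (q : {ffun 'I_d -> 'I_N}) :
  cube (grid q) (2^-1 / N%:R) `<=` unit_cube.
Proof.
move=> x /grid_cubeP qx i.
have N0 : (0 : R) < N%:R by rewrite ltr0n (leq_ltn_trans _ (ltn_ord (q i))).
have /andP[q1 q2] := qx i; have q3 : (q i)%:R + 1 <= N%:R :> R.
  by rewrite natr1 ler_nat.
apply/andP; split.
  by rewrite -(pmulr_rge0 _ N0) (le_trans _ q1).
by rewrite -(ler_pM2l N0) mulr1 (le_trans q2).
Qed.

Definition straddles A G := A `&` G !=set0 /\ ~ (A `<=` G).

(** A straddling cell meets the boundary of [G], whose part in the unit cube is compact. Finitely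
    many fattened boxes of small total volume cover that part, and on a fine grid the number of
    cells meeting a box is at most N^d times the volume of a slightly larger box. *)
Lemma straddle_content G (e : R) : lebesgue_Rd (boundary G) = 0%E -> 0 < e ->
  exists n0, forall n, (n0 <= n)%N ->
    #|[pred q : {ffun 'I_d -> 'I_n.+1} |
      `[< straddles (cube (grid q) (2^-1 / n.+1%:R)) G >]]|%:R
    <= e * n.+1%:R ^+ d.
Proof.
move=> G0 e0; have e20 : 0 < e / 2 by lra.
have : (lebesgue_Rd (boundary G) < (e / 2)%:E)%E by rewrite G0 lte_fin.
move=> /ereal_inf_lt[_ [a [b [Gab ->]]] Le].
have g0 k : 0 < e / 2 * 2^-1 ^+ k.+1 by rewrite mulr_gt0.
have /choice[s0 s0P] k : exists s, 0 < s /\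
    \prod_(i < d) Num.max 0 ((b k 0 i - a k 0 i) + s) <=
    box_volume (a k) (b k) + e / 2 * 2^-1 ^+ k.+1.
  by have [s] := prod_max_near (fun i => b k 0 i - a k 0 i) (g0 k); exists s.
have s00 k := (s0P k).1; have sP k := (s0P k).2.
(* Two thirds of [s0] fatten the box on both sides; the last third absorbs the excess 2/N in the
   count of cells. *)
pose s k := s0 k / 3.
have s_gt0 k : 0 < s k by rewrite divr_gt0.
pose U k := [set x : 'rV[R]_d | forall i, a k 0 i - s k < x 0 i < b k 0 i + s k].
have oU k : open (U k).
  rewrite openE => x Ux; rewrite /interior/=.
  apply: (@filter_forall _ _ _ (nbhs x) (nbhs_filter x)) => i.
  have : nbhs (x 0 i) `]a k 0 i - s k, b k 0 i + s k[%classic.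
    by apply: open_nbhs_nbhs; split=> //; rewrite /= in_itv/=; exact: Ux.
  move=> /(@coord_continuous R 1 d 0 i x) H.
  apply: (@filterS _ (nbhs x) (nbhs_filter x) _ _ _ H) => y /=.
  by rewrite in_itv.
have cK : compact (boundary G `&` unit_cube).
  rewrite setIC; apply: compact_closedI; first exact: unit_cube_compact.
  by apply: closedI; [exact: closed_closure|apply: open_closedC; exact: open_interior].
move: cK; rewrite compact_cover => /(_ _ setT U (fun k _ => oU k))[].
  move=> x [/Gab[k _ kx] _]; exists k => // i.
  by have /andP[? ?] := kx i; have := s_gt0 k; lra.
move=> D _ KD; pose M := (\max_(k <- finmap.enum_fset D) k).+1.
have DM k : k \in finmap.enum_fset D -> (k < M)%N.
  by move=> kD; rewrite ltnS; exact: (@leq_bigmax_seq _ _ xpredT id).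
(* The mesh is fine enough for all of the finitely many boxes kept. *)
have [n0 n0P] : exists n0 : nat, forall k, (k < M)%N -> 2 / n0.+1%:R <= s k.
  elim: M {DM} => [|M [n0 IH]]; first by exists 0%N.
  have /cvgrPdist_lt/(_ _ (s_gt0 M))[n1 _ n1P] := @cvg_harmonic R.
  exists (maxn n0 (n1 + n1).+1) => k; rewrite ltnS leq_eqVlt => /orP[/eqP ->|kM].
    have := n1P n1 (leqnn _); rewrite /harmonic sub0r normrN ger0_norm ?invr_ge0//.
    move=> /ltW; apply: le_trans; rewrite ler_pdivrMr// ler_pdivlMl//.
    rewrite -natrM ler_nat; lia.
  apply: le_trans (IH _ kM); rewrite ler_pM2l// lef_pV2 ?posrE// ler_nat; lia.
exists n0 => n n0n; set N := n.+1.
have N0 : (0 : R) < N%:R by rewrite ltr0n.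
pose B k := [pred q : {ffun 'I_d -> 'I_N} |
  `[< cube (grid q) (2^-1 / N%:R) `&` U k !=set0 >]].
have BP k : (k < M)%N -> #|B k|%:R <=
    N%:R ^+ d * (box_volume (a k) (b k) + e / 2 * 2^-1 ^+ k.+1).
  move=> kM; pose u i := N%:R * (a k 0 i - s k) - 1.
  pose v i := N%:R * (b k 0 i + s k).
  apply: (@le_trans _ _ (\prod_(i < d) Num.max 0 (v i - u i + 1))).
    apply: card_box_le => q /asboolP[x [/grid_cubeP qx Ux]] i; rewrite /u /v.
    have /andP[q1 q2] := qx i; have /andP[U1 U2] := Ux i.
    rewrite lerBlDr (le_trans _ q2) ?(le_trans q1)// ler_pM2l// ltW//.
  apply: (@le_trans _ _ (\prod_(i < d)
      (N%:R * Num.max 0 ((b k 0 i - a k 0 i) + s0 k)))).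
    apply: ler_prod => i _; rewrite le_max lexx/=.
    rewrite maxr_pMr ?(ltW N0)// mulr0 ge_max le_max lexx/= le_max; apply/orP; right.
    have /= : 2 / N%:R <= s k.
      by apply: le_trans (n0P _ kM); rewrite ler_pM2l// lef_pV2 ?posrE// ler_nat.
    rewrite ler_pdivrMr// /u /v /s; nra.
  rewrite big_split/= prodr_const card_ord ler_pM2l ?exprn_gt0//; exact: sP.
apply: (@le_trans _ _ (\sum_(k < M) #|B k|%:R)).
  rewrite -natr_sum ler_nat -sum1_card/=.
  under [leqRHS]eq_bigr do rewrite -sum1_card big_mkcond/=.
  rewrite exchange_big/= big_mkcond/=; apply: leq_sum => q _; case: ifPn => //.
  move=> /asboolP[qG qG'].
  have [||x [qx xG]] := @cube_meets_boundary (grid q) (2^-1 / N%:R) G; [by []|by []|].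
  have [k kD Ux] := KD x (conj xG (grid_cube_sub qx)).
  rewrite (bigD1 (Ordinal (DM k kD)))//= ifT//.
  by apply/asboolP; exists x.
apply: le_trans (ler_sum _ (fun (k : 'I_M) _ => BP k (ltn_ord k))) _.
rewrite -mulr_sumr mulrC ler_pM2r ?exprn_gt0// big_split/= -mulr_sumr.
(* One half bounds the volumes of the boxes, the other the geometric series of the fattening
   costs. *)
have -> : e = e / 2 + e / 2 by lra.
apply: lerD.
  rewrite -lee_fin -sumEFin; apply: le_trans (ltW Le).
  rewrite -(big_mkord xpredT (fun k => (box_volume (a k) (b k))%:E)).
  apply: nneseries_lim_ge => k _ _; rewrite lee_fin prodr_ge0// => i _.
  by rewrite le_max lexx.
have -> : e / 2 + e / 2 = e by lra.
rewrite -[leRHS]mulr1 ler_pM2l//.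
have E (m : nat) : \sum_(k < m) (2^-1 : R) ^+ k.+1 = 1 - 2^-1 ^+ m.
  by elim: m => [|m IH]; rewrite ?big_ord0 ?expr0 ?subrr// big_ord_recr/= IH exprS; lra.
by rewrite E gerBl exprn_ge0.
Qed.

End content.

(** * The intensity measure *)

Lemma integral_sum_indic (dT : measure_display) (T : measurableType dT)
    (R : realType) (m : {measure set T -> \bar R}) (D : set T) (I : finType)
    (c : I -> R) (A : I -> set T) :
  measurable D -> (forall i, 0 <= c i) -> (forall i, measurable (A i)) ->
  (\int[m]_(x in D) (\sum_i c i * \1_(A i) x)%:E =
   \sum_i (c i)%:E * m (A i `&` D))%E.
Proof.
move=> mD c0 mA.
have mi i : measurable_fun D (fun x => (c i * \1_(A i) x)%:E).
  apply/measurable_EFinP; apply: (@measurable_funM _ _ _ _ (cst (c i))) => //.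
under eq_integral do rewrite -sumEFin.
rewrite ge0_integral_sum//; last first.
  by move=> i x _; rewrite lee_fin mulr_ge0.
apply: eq_bigr => i _; under eq_integral do rewrite EFinM.
rewrite ge0_integralZl_EFin//; first by rewrite integral_indic.
exact/measurable_EFinP/measurable_indic.
Qed.

Section intensity.
Variables (R : realType) (d : nat).
Local Notation GG := (small_set R d).
Variables (F : set (set GG)) (F_suitable : suitable F).
Variable mu : {measure set (g_sigma_algebraType F) -> \bar R}.
Hypothesis mu_translation : translation_invariant F mu.
Hypothesis mu_scale : semi_scale_invariant F mu.
Hypothesis mu_hitting : forall (A : set 'rV[R]_d) (delta : R),
  bounded_set A -> 0 < delta -> (mu (hitting A delta) < +oo)%E.

Let meas (D : set GG) := measurable (D : set (g_sigma_algebraType F)).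

Lemma measurableF D : meas D <-> F D.
Proof.
suff -> : meas D = F D by [].
rewrite -[in RHS](sigma_algebra_id (suitable_sigma_algebra F_suitable)).
by [].
Qed.

(** The families known to be measurable bound the diameter only from below, so a band is a
    difference of two of them. *)
Lemma hitE A k :
  hit A k = hitting A (2^-1 ^+ k.+1) `\` hitting A (2^-1 ^+ k) :> set GG.
Proof.
apply/seteqP; split=> [G [GA [b1 b2]]|G [[GA b1] nG]].
  by split=> //; case=> _; rewrite leNgt b2.
by split=> //; split=> //; rewrite ltNge; apply/negP => b2; exact: nG.
Qed.

Lemma contE A k :
  cont A k = containing A (2^-1 ^+ k.+1) `\` containing A (2^-1 ^+ k) :> set GG.
Proof.
apply/seteqP; split=> [G [GA [b1 b2]]|G [[GA b1] nG]].
  by split=> //; case=> _; rewrite leNgt b2.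
by split=> //; split=> //; rewrite ltNge; apply/negP => b2; exact: nG.
Qed.

Lemma measurable_hitting A (e : R) : bounded_set A -> 0 < e -> meas (hitting A e).
Proof. by move=> bA e0; apply/measurableF; exact: suitable_hitting. Qed.

Lemma measurable_containing A (e : R) : compact A -> 0 < e -> meas (containing A e).
Proof. by move=> bA e0; apply/measurableF; exact: suitable_containing. Qed.

Lemma measurable_hit A k : bounded_set A -> meas (hit A k).
Proof.
by move=> bA; rewrite /meas hitE; apply: measurableD;
  apply: measurable_hitting => //; exact: exp_half_gt0.
Qed.

Lemma measurable_cont A k : compact A -> meas (cont A k).
Proof.
by move=> bA; rewrite /meas contE; apply: measurableD;
  apply: measurable_containing => //; exact: exp_half_gt0.
Qed.

Lemma mu_hit_fin A k : bounded_set A -> (mu (hit A k) < +oo)%E.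
Proof.
move=> bA; apply: le_lt_trans (mu_hitting bA (exp_half_gt0 R k.+1)).
apply: le_measure; rewrite ?inE; first exact: measurable_hit.
  by apply: measurable_hitting => //; exact: exp_half_gt0.
by rewrite hitE => G [].
Qed.

Lemma cont_sub_hit (c : 'rV[R]_d) r k : 0 <= r ->
  cont (cube c r) k `<=` hit (cube c r) k.
Proof.
move=> r0 G [rG bG]; split=> //; exists c; split; last exact: cubexx.
by apply: rG; exact: cubexx.
Qed.

Lemma mu_cont_fin c r k : 0 <= r -> (mu (cont (cube c r) k) < +oo)%E.
Proof.
move=> r0; apply: le_lt_trans (mu_hit_fin k (cube_bounded c r)).
apply: le_measure; rewrite ?inE; last exact: cont_sub_hit.
  by apply: measurable_cont; exact: cube_compact.
by apply: measurable_hit; exact: cube_bounded.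
Qed.

Lemma mu_transport c s D : 0 < s <= 1 -> meas D -> (mu D < +oo)%E ->
  meas (transport c s D) /\ mu (transport c s D) = mu D.
Proof.
move=> s01 /measurableF FD Dfin; rewrite -translate_dilate//.
have s0 : 0 < s by case/andP: s01.
have sm : dilate_small s D by exact: dilate_small_le1.
have Fs : F (@shape R d @^-1` dilate s D) by exact: (suitable_dilate F_suitable).
split; first by apply/measurableF; exact: (suitable_translate F_suitable).
by rewrite mu_translation// mu_scale.
Qed.

Lemma mu_hit_cube c r k :
  mu (hit (cube c (2^-1 ^+ k * r)) k) = mu (hit (cube 0 r) 0).
Proof.
rewrite -transport_hit (mu_transport _ _ _ _).2 ?exp_half_gt0 ?exp_half_le1//.
  by apply: measurable_hit; exact: cube_bounded.
by apply: mu_hit_fin; exact: cube_bounded.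
Qed.

Lemma mu_cont_cube c r k : 0 <= r ->
  mu (cont (cube c (2^-1 ^+ k * r)) k) = mu (cont (cube 0 r) 0).
Proof.
move=> r0; rewrite -transport_cont (mu_transport _ _ _ _).2 ?exp_half_gt0 ?exp_half_le1//.
  by apply: measurable_cont; exact: cube_compact.
exact: mu_cont_fin.
Qed.

Lemma calA1E : @calA1 R d = hit [set 0] 0.
Proof.
rewrite /hit band0E; apply/seteqP; split=> [G [G0 d1 d2]|G [[x [Gx x0]] d1]].
  by split=> //; exists 0.
by rewrite x0 in Gx; split=> //; exact: (svalP G).
Qed.

Lemma measurable_calA1 : meas (@calA1 R d).
Proof. by apply/measurableF; exact: (suitable_calA1 F_suitable). Qed.

Lemma cont_sub_calA1 r : 0 <= r -> cont (cube 0 r) 0 `<=` @calA1 R d.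
Proof.
move=> r0 G [rG bG]; rewrite calA1E; split=> //; exists 0; split=> //.
by apply: rG; exact: cubexx.
Qed.

Lemma calA1_sub_hit r : 0 <= r -> @calA1 R d `<=` hit (cube 0 r) 0.
Proof.
move=> r0 G; rewrite calA1E => -[[x [Gx x0]] bG]; split=> //.
by rewrite x0 in Gx; exists 0; split=> //; exact: cubexx.
Qed.

Lemma mu_calA1_fin : (mu (@calA1 R d) < +oo)%E.
Proof.
apply: le_lt_trans (mu_hit_fin 0 (cube_bounded (0 : 'rV[R]_d) 0)).
apply: le_measure; rewrite ?inE; last exact: calA1_sub_hit.
  exact: measurable_calA1.
by apply: measurable_hit; exact: cube_bounded.
Qed.

Lemma lebesgue_Rd_ge0 (A : set 'rV[R]_d) : (0 <= lebesgue_Rd A)%E.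
Proof.
apply: le_ereal_inf_tmp => _ [a [b [_ ->]]]; apply: nneseries_ge0 => k _ _.
by rewrite lee_fin prodr_ge0// => i _; rewrite le_max lexx.
Qed.

Hypothesis mu_fat_boundary : mu (@fat_boundary R d) = 0%E.

(** By translation invariance the difference is the same for every cell of the grid, so it is the
    integral over [G] of the fraction of cells which [G] hits without containing. For almost every
    [G] this fraction tends to 0 by [straddle_content]. *)
Lemma mu_straddle_cvg0 :
  (mu (hit (cube 0 (2^-1 / n.+1%:R)) 0) - mu (cont (cube 0 (2^-1 / n.+1%:R)) 0)
    @[n --> \oo] --> 0)%E.
Proof.
pose r n : R := 2^-1 / n.+1%:R.
have r0 n : 0 <= r n by rewrite divr_ge0.
pose S n (q : {ffun 'I_d -> 'I_n.+1}) : set GG :=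
  hit (cube (grid R q) (r n)) 0 `\` cont (cube (grid R q) (r n)) 0.
have mS n q : meas (S n q).
  apply: measurableD; first by apply: measurable_hit; exact: cube_bounded.
  by apply: measurable_cont; exact: cube_compact.
(* All cells lie in the unit cube, so the fractions are supported in [D], whose finite mass makes
   the dominating constant 1 integrable. *)
pose D : set GG := hit (@unit_cube R d) 0.
have mD : meas D.
  by apply: measurable_hit; apply: compact_bounded; exact: unit_cube_compact.
have Dfin : (mu D < +oo)%E.
  by apply: mu_hit_fin; apply: compact_bounded; exact: unit_cube_compact.
have SD n q : S n q `<=` D.
  move=> G [[[x [Gx qx]] bG] _]; split=> //; exists x; split=> //.
  exact: grid_cube_sub qx.
pose f n (G : g_sigma_algebraType F) : \bar R :=
  (\sum_q n.+1%:R ^- d * \1_(S n q) G)%:E.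
have fcount n G : f n G = (n.+1%:R ^- d * #|[pred q | `[< S n q G >]]|%:R)%:E.
  congr EFin; rewrite -mulr_sumr; congr (_ * _).
  rewrite -sum1_card natr_sum [RHS]big_mkcond/=; apply: eq_bigr => q _.
  have [SG|SG] := pselect (S n q G).
    by rewrite indicE mem_set// ifT//; exact/asboolP.
  by rewrite indicE memNset// ifF//; exact/asboolP.
have f_le n G : (`|f n G| <= 1)%E.
  rewrite fcount gee0_abs ?lee_fin ?mulr_ge0// ?invr_ge0 ?exprn_ge0//.
  rewrite mulrC ler_pdivrMr ?exprn_gt0// mul1r -natrX ler_nat.
  by rewrite (leq_trans (max_card _))// card_ffun !card_ord.
have intf n : (\int[mu]_(G in D) f n G =
    mu (hit (cube 0 (r n)) 0) - mu (cont (cube 0 (r n)) 0))%E.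
  have c0 : 0 <= (n.+1%:R : R) ^- d by rewrite invr_ge0 exprn_ge0.
  rewrite (integral_sum_indic mu mD (fun=> c0) (mS n)).
  have E q : mu (S n q `&` D) =
      (mu (hit (cube 0 (r n)) 0) - mu (cont (cube 0 (r n)) 0))%E.
    rewrite (setIidl (@SD _ _)) measureD; last first.
    - by apply: mu_hit_fin; exact: cube_bounded.
    - by apply: measurable_cont; exact: cube_compact.
    - by apply: measurable_hit; exact: cube_bounded.
    rewrite (setIidr (@cont_sub_hit _ _ _ (r0 n))).
    have := mu_hit_cube (grid R q) (r n) 0; have := mu_cont_cube (grid R q) 0 (r0 n).
    by rewrite !expr0 !mul1r => <- <-.
  rewrite (eq_bigr (fun q => (n.+1%:R ^- d)%:E * 
    (mu (hit (cube 0 (r n)) 0) - mu (cont (cube 0 (r n)) 0))))%E; last first.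
    by move=> q _; rewrite E.
  have hf : mu (hit (cube 0 (r n)) 0) \is a fin_num.
    by rewrite ge0_fin_numE// mu_hit_fin//; exact: cube_bounded.
  have cf : mu (cont (cube 0 (r n)) 0) \is a fin_num.
    by rewrite ge0_fin_numE// mu_cont_fin.
  rewrite -(fineK hf) -(fineK cf) -EFinB -EFinM sumEFin; congr EFin.
  rewrite sumr_const card_ffun !card_ord -[(_ * _) *+ _]mulr_natr natrX mulrAC.
  by rewrite mulVf ?mul1r.
have [|||||_ _] := @dominated_convergence _ _ _ mu D mD f (cst 0%E) (cst 1%E).
- move=> n; apply/measurable_EFinP; apply: measurable_sum => q.
  apply: (@measurable_funM _ _ _ _ (cst (n.+1%:R ^- d))) => //.
  have Sm : measurable (S n q : set (g_sigma_algebraType F)) := mS n q.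
  exact: (@measurable_indic _ (g_sigma_algebraType F) R D (S n q)).
- exact: measurable_cst.
- exists (@fat_boundary R d); split=> //.
    by apply/measurableF; exact: (suitable_fat_boundary F_suitable).
  move=> G /= nG; apply: contrapT => fG; apply: nG => DG.
  have G0 : lebesgue_Rd (boundary (shape G)) = 0%E.
    apply/eqP; rewrite eq_le lebesgue_Rd_ge0 andbT leNgt; exact/negP.
  have -> : f ^~ G = EFin \o (fun n => n.+1%:R ^- d * #|[pred q | `[< S n q G >]]|%:R).
    by apply/funext => n; rewrite fcount.
  apply: cvg_EFin; first by near=> n.
  apply/cvgrPdist_le => e e0; have [n0 n0P] := straddle_content G0 e0.
  exists n0 => // n /= n0n; rewrite sub0r normrN ger0_norm; last first.
    by rewrite mulr_ge0// invr_ge0 exprn_ge0.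
  rewrite mulrC ler_pdivrMr ?exprn_gt0//; apply: le_trans (n0P n n0n).
  rewrite ler_nat; apply: subset_leq_card; apply/fintype.subsetP => q.
  rewrite !inE; move=> [[[x [Gx qx]] bG] nc]; split.
    by exists x.
  by move=> qG; apply: nc; split.
- apply/integrableP; split; first exact: measurable_cst.
  by rewrite /= integral_cst//= normr1 mul1e.
- by apply/aeW => G n _; exact: f_le.
rewrite integral0; under eq_fun do rewrite intf.
by [].
Unshelve. all: end_near. Qed.

End intensity.

(** * Finite and countable unions, lattice points *)

Lemma measure_bigcup_fin_le (dT : measure_display) (T : measurableType dT)
    (R : realType) (m : {measure set T -> \bar R}) (I : finType)
    (A : I -> set T) : (forall i, measurable (A i)) ->
  measurable [set x | exists i, A i x] /\
  (m [set x | exists i, A i x] <= \sum_i m (A i))%E.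
Proof.
move=> mA.
have -> : [set x | exists i, A i x] = \big[setU/set0]_(i <- enum I) A i.
  rewrite -bigcup_seq; apply/seteqP; split=> [x [i Ai]|x [i _ Ai]]; exists i => //=.
  by rewrite mem_enum.
rewrite [X in (_ <= X)%E](_ : _ = \sum_(i <- enum I) m (A i))%E; last first.
  by rewrite big_enum.
split; first exact: bigsetU_measurable.
elim: (enum I) => [|i s IH]; first by rewrite !big_nil measure0.
rewrite !big_cons; apply: le_trans (leeD2l _ IH).
by apply: measureU2 => //; exact: bigsetU_measurable.
Qed.

Lemma negligible_bigcup_count (dT : measure_display) (T : measurableType dT)
    (R : realType) (m : {measure set T -> \bar R}) (I : countType)
    (A : I -> set T) : (forall i, m.-negligible (A i)) ->
  m.-negligible [set x | exists i, A i x].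
Proof.
move=> nA; pose B n := if unpickle n is Some i then A i else set0.
apply: (@negligibleS _ _ _ _ (\bigcup_n B n)).
  by move=> x [i Ai]; exists (pickle i) => //; rewrite /B pickleK.
apply: negligible_bigcup => n; rewrite /B; case: unpickle => [i|] //.
exact: negligible_set0.
Qed.

Lemma lattice_point (R : realType) (d n : nat) (x : 'rV[R]_d) :
  exists z : {ffun 'I_d -> int}, forall i,
    0 <= x 0 i - (z i)%:~R / n.+1%:R <= n.+1%:R^-1.
Proof.
exists [ffun i => Num.floor (n.+1%:R * x 0 i)] => i; rewrite ffunE.
have N0 : (0 : R) < n.+1%:R by rewrite ltr0n.
have := ge_floor (n.+1%:R * x 0 i); have := floorD1_gt (n.+1%:R * x 0 i).
rewrite intrD => /ltW h2 h1.
rewrite subr_ge0 ler_pdivrMr// [_ * n.+1%:R]mulrC h1/= lerBlDr.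
by rewrite -(ler_pM2l N0) mulrDr divff ?gt_eqF// mulrCA divff ?gt_eqF// mulr1 addrC.
Qed.

(** * Disjointness of the bands and positivity of the mass of [calA1] *)

Section intensity.
Variables (R : realType) (d : nat).
Local Notation GG := (small_set R d).
Variables (F : set (set GG)) (F_suitable : suitable F).
Variable mu : {measure set (g_sigma_algebraType F) -> \bar R}.
Hypothesis mu_translation : translation_invariant F mu.
Hypothesis mu_scale : semi_scale_invariant F mu.
Hypothesis mu_hitting : forall (A : set 'rV[R]_d) (delta : R),
  bounded_set A -> 0 < delta -> (mu (hitting A delta) < +oo)%E.
Hypothesis mu_fat_boundary : mu (@fat_boundary R d) = 0%E.

Let meas (D : set GG) := measurable (D : set (g_sigma_algebraType F)).

Lemma bandP n (G : GG) : ((2^-1 ^+ n)%:E <= diam (shape G))%E ->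
  exists2 k, (k < n)%N & band k G.
Proof.
elim: n => [|n IH] dG; first by have := svalP G; rewrite ltNge => /negP.
have [/IH[k kn bk]|Gn] := leP (2^-1 ^+ n)%:E (diam (shape G)).
  by exists k => //; rewrite ltnS ltnW.
by exists n.
Qed.

Lemma band_inj k j (G : GG) : band k G -> band j G -> k = j.
Proof.
have lt a b : band a G -> band b G -> ~~ (a < b)%N.
  move=> [a1 _] [_ b1]; apply/negP => ab.
  have := le_lt_trans a1 b1.
  rewrite lte_fin ltNge => /negP; apply.
  by rewrite ler_wiXn2l//; lra.
move=> bk bj; apply/eqP; rewrite eqn_leq.
by rewrite leqNgt (lt _ _ bj bk) leqNgt (lt _ _ bk bj).
Qed.

(** If [calA1] were null, then by invariance so would be the sets of any band containing any given
    point. A fat set with null boundary has interior points, hence positive diameter and a rational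
    point, so it would lie in a countable union of null families. *)
Lemma mu_calA1_gt0 : (0 < d)%N -> (0 < mu (@fat R d))%E ->
  (0 < mu (@calA1 R d))%E.
Proof.
move=> d0 fat0; rewrite lt0e measure_ge0 andbT; apply/eqP => A0.
have ncont c k : mu.-negligible (cont (cube c 0) k).
  have mc : meas (cont (cube c 0) k) by apply: measurable_cont => //; exact: cube_compact.
  exists (cont (cube c 0) k); split=> //.
  have -> : mu (cont (cube c 0) k) = mu (cont (cube 0 0) 0).
    have := mu_cont_cube F_suitable mu_translation mu_scale mu_hitting c k (lexx 0).
    by rewrite mulr0.
  apply: (@subset_measure0 _ _ _ mu _ (@calA1 R d)) => //.
  - by apply: measurable_cont => //; exact: cube_compact.
  - exact: (measurable_calA1 F_suitable).
  - exact: cont_sub_calA1.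
suff : mu.-negligible (@fat R d).
  move=> /(measure_negligible _) => /(_ _)H; move: fat0; rewrite H ?ltxx//.
  by apply/(measurableF F_suitable); exact: (suitable_fat F_suitable).
pose B : set (g_sigma_algebraType F) := @fat_boundary R d `|`
  [set G | exists p : {ffun 'I_d -> int} * nat, exists k : nat,
     cont (cube (\row_i ((p.1 i)%:~R / p.2.+1%:R)) 0) k G].
apply: (@negligibleS _ _ _ mu B); last first.
  apply: negligibleU.
    exists (@fat_boundary R d); split=> //.
    by apply/(measurableF F_suitable); exact: (suitable_fat_boundary F_suitable).
  by apply: negligible_bigcup_count => p; exact: negligible_bigcup_count.
move=> G fG; have [?|nb] := pselect (fat_boundary G); [by left|right].
(* With empty interior, [shape G] would be part of its own boundary, which would then be fat. *)
have [x Gx] : interior (shape G) !=set0.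
  apply/set0P/negP => /eqP i0; apply: nb; apply: lt_le_trans fG _.
  apply: le_ereal_inf_tmp => _ [a [b [ab ->]]]; apply: ereal_inf_lbound.
  exists a, b; split=> //; apply: subset_trans ab => y Gy; split.
    exact: subset_closure.
  by rewrite i0.
have [e /= e0 eG] := (nbhs_ballP x (shape G)).1 Gx.
have [n n2] : exists n : nat, 2 / n.+1%:R < e.
  have e20 : 0 < e / 2 by lra.
  have /cvgrPdist_lt/(_ _ e20)[n _ nP] := @cvg_harmonic R.
  exists n; have := nP n (leqnn _).
  rewrite /harmonic sub0r normrN ger0_norm ?invr_ge0// => h.
  by rewrite mulrC -ltr_pdivlMr.
have [z zP] := lattice_point n x.
set c : 'rV[R]_d := \row_i ((z i)%:~R / n.+1%:R).
have N0 : (0 : R) < n.+1%:R^-1 by rewrite invr_gt0 ltr0n.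
have cG : cube c (n.+1%:R^-1) `<=` shape G.
  move=> y cy; apply: eG; split=> // i j; rewrite ord1 -ball_normE /ball_/=.
  apply: le_lt_trans n2.
  have := zP j; have := cy j; rewrite mxE.
  move: (n.+1%:R^-1) ((z j)%:~R / n.+1%:R) => u v h /andP[h3 h4].
  by move: h; rewrite !ler_distl => /andP[h1 h2]; apply/andP; split; lra.
(* A corner of the cube, at distance at least 1/(n+1) from the centre because there is at least one
   coordinate; this bounds the diameter below. *)
pose y : 'rV[R]_d := \row_i (c 0 i + n.+1%:R^-1).
have dG : ((2^-1 ^+ n.+1)%:E <= diam (shape G))%E.
  have h : ((euclid_norm (y - c))%:E <= diam (shape G))%E.
    apply: euclid_le_diam; apply: cG; last by apply: cubexx; exact: ltW.
    by move=> i; rewrite mxE addrC addKr gtr0_norm.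
  apply: le_trans h; rewrite lee_fin.
  apply: le_trans (coord_le_euclid (y - c) (Ordinal d0)).
  rewrite !mxE [_ + n.+1%:R^-1]addrC addrK gtr0_norm// exprVn.
  rewrite lef_pV2 ?posrE ?exprn_gt0//.
  by rewrite -natrX ler_nat ltnW// ltn_expl.
have [k _ bk] := bandP dG.
exists (z, n); exists k; split=> // v cv; apply: cG.
exact: (sub_cube (ltW N0) cv).
Qed.

End intensity.

(** * Vacancy probabilities and covering *)

Lemma counting_eq0 (T : choiceType) (R : realType) (A : set T) :
  counting A = 0%E :> \bar R <-> A = set0.
Proof.
rewrite /counting; split=> [|->]; last first.
  by rewrite asboolT// fset_set0.
case: asboolP => [fA [] /eqP|_ //]; rewrite pnatr_eq0 => /nilP E.
apply/seteqP; split=> // x Ax; have : x \in finmap.enum_fset (fset_set A).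
  have -> : (x \in finmap.enum_fset (fset_set A)) = (x \in A) by exact: in_fset_set.
  exact/mem_set.
by rewrite E.
Qed.

Lemma grid_cover (R : realType) (d N : nat) (x : 'rV[R]_d) : (0 < N)%N ->
  (forall i, 0 <= x 0 i <= 1) ->
  exists q : {ffun 'I_d -> 'I_N}, cube (grid R q) (2^-1 / N%:R) x.
Proof.
move=> N0 x01; suff /choice[q qP] i : exists k : 'I_N,
    k%:R <= N%:R * x 0 i <= (k%:R : R) + 1.
  by exists [ffun i => q i]; apply/grid_cubeP => i; rewrite ffunE.
have /andP[x0 x1] := x01 i; have Nx0 : 0 <= N%:R * x 0 i by rewrite mulr_ge0.
have [kN|Nk] := ltnP (Num.truncn (N%:R * x 0 i)) N.
  exists (Ordinal kN) => /=; have /andP[-> /ltW] := truncn_itv Nx0.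
  by rewrite -natr1.
(* Only the right endpoint 1 is left; it goes to the last cell. *)
have kN : (N.-1 < N)%N by rewrite prednK.
exists (Ordinal kN) => /=; rewrite natr1 prednK//; apply/andP; split.
  apply: le_trans (_ : (Num.truncn (N%:R * x 0 i))%:R <= _).
    by rewrite ler_nat (leq_trans _ Nk)// leq_pred.
  by have /andP[] := truncn_itv Nx0.
by rewrite -[leRHS]mulr1 ler_wpM2l.
Qed.

Section process.
Variables (R : realType) (d : nat).
Local Notation GG := (small_set R d).
Variables (F : set (set GG)) (F_suitable : suitable F).
Variable mu : {measure set (g_sigma_algebraType F) -> \bar R}.
Hypothesis mu_translation : translation_invariant F mu.
Hypothesis mu_scale : semi_scale_invariant F mu.
Hypothesis mu_hitting : forall (A : set 'rV[R]_d) (delta : R),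
  bounded_set A -> 0 < delta -> (mu (hitting A delta) < +oo)%E.
Variables (dO : measure_display) (Omega : measurableType dO).
Variables (P : probability Omega R) (Phi : Omega -> configuration R d) (l : R).
Hypothesis l_gt0 : 0 < l.
Hypothesis Phi_poisson : poisson_process F (fun D => (l%:E * mu D)%E) P Phi.

Let meas (D : set GG) := measurable (D : set (g_sigma_algebraType F)).

Definition vacant (D : set GG) : set Omega :=
  [set w | forall i G, Phi w i = Some G -> ~ D G].

Lemma vacantE D : vacant D = [set w | npoints (Phi w) D = 0%E].
Proof.
apply/seteqP; split=> w /=; rewrite /npoints counting_eq0.
  by move=> vw; apply/seteqP; split=> // i [G DG] /vw.
move=> E i G wG DG; suff : [set i | exists2 G, D G & Phi w i = Some G] i by rewrite E.
by exists G.
Qed.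

Lemma measurable_vacant D : meas D -> measurable (vacant D).
Proof.
move=> /(measurableF F_suitable) FD; rewrite vacantE.
have := npoints_measurable Phi_poisson FD measurableT (emeasurable_set1 0%E).
by rewrite setTI.
Qed.

Lemma prob_vacant D : meas D -> (mu D < +oo)%E ->
  P (vacant D) = (expR (- (l * fine (mu D))))%:E.
Proof.
move=> /(measurableF F_suitable) FD Dfin.
have muD : mu D = (fine (mu D))%:E by rewrite fineK// ge0_fin_numE.
have nuD : ((l%:E * mu D) < +oo)%E by rewrite muD -EFinM ltry.
rewrite vacantE (npoints_poisson Phi_poisson FD nuD 0%N) /poisson_prob.
rewrite [in fine _]muD -EFinM /=; case: ifPn => [l0|].
  by rewrite esum_set1 /poisson_pmf l0 ?expr0 ?fact0 ?divr1 ?mul1r// lee_fin expR_ge0.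
(* A rate which is not positive is 0, where the Poisson law is the Dirac mass at 0. *)
rewrite -leNgt => l0; rewrite diracE mem_set//.
have -> : l * fine (mu D) = 0.
  by apply/eqP; rewrite eq_le l0/= mulr_ge0 ?fine_ge0// ltW.
by rewrite oppr0 expR0.
Qed.

(** For each [k <= n], a set of band [k] containing the cube of radius 2^-k r contains the smaller
    one of radius 2^-n r. These n+1 bands are disjoint and contribute equal masses. *)
Lemma mu_containing_ge c r n : 0 <= r ->
  (n.+1%:R%:E * mu (cont (cube 0 r) 0) <=
   mu (containing (cube c (2^-1 ^+ n * r)) (2^-1 ^+ n.+1)))%E.
Proof.
move=> r0; pose B (k : 'I_n.+1) : set (g_sigma_algebraType F) :=
  cont (cube c (2^-1 ^+ k * r)) k.
have mB k : measurable (B k) by apply: measurable_cont => //; exact: cube_compact.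
have tB : trivIset setT B.
  move=> i j _ _ [G [[_ bi] [_ bj]]]; apply: val_inj; exact: band_inj bi bj.
have -> : (n.+1%:R%:E * mu (cont (cube 0 r) 0) = mu (\big[setU/set0]_k B k))%E.
  rewrite measure_bigsetU_ord// (eq_bigr (fun=> mu (cont (cube 0 r) 0))).
    have cf : mu (cont (cube 0 r) 0) \is a fin_num.
      by rewrite ge0_fin_numE//; exact: mu_cont_fin.
    by rewrite -(fineK cf) -EFinM sumEFin sumr_const card_ord mulr_natl.
  by move=> k _; exact: mu_cont_cube.
apply: le_measure; rewrite ?inE.
- exact: bigsetU_measurable.
- apply: measurable_containing => //; exact: cube_compact.
rewrite -bigcup_seq => G [k _ [cG [bk _]]]; split.
  apply: subset_trans cG; apply: sub_cube; rewrite ler_wpM2r//.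
  by rewrite ler_wiXn2l// ?invr_ge0 ?invf_le1 ?ler1n// -ltnS.
apply: le_trans bk; rewrite lee_fin ler_wiXn2l ?invr_ge0 ?invf_le1 ?ler1n//.
Qed.

Lemma prob_vacant_containing c r n : 0 <= r ->
  (P (vacant (containing (cube c (2^-1 ^+ n * r)) (2^-1 ^+ n.+1))) <=
   (expR (- (l * fine (mu (cont (cube 0 r) 0)))) ^+ n.+1)%:E)%E.
Proof.
move=> r0; set D := containing _ _.
have mD : meas D.
  by apply: measurable_containing => //; exact: cube_compact.
have cf : mu (cont (cube 0 r) 0) \is a fin_num.
  by rewrite ge0_fin_numE//; exact: mu_cont_fin.
have Dfin : (mu D < +oo)%E.
  apply: le_lt_trans (mu_hitting (cube_bounded c (2^-1 ^+ n * r)) (exp_half_gt0 R n.+1)).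
  apply: le_measure; rewrite ?inE//.
    by apply: measurable_hitting => //; exact: cube_bounded.
  move=> G [cG dG]; split=> //; exists c.
  have cc : cube c (2^-1 ^+ n * r) c.
    by apply: cubexx; rewrite mulr_ge0// ltW ?exp_half_gt0.
  by split=> //; exact: cG.
rewrite prob_vacant// lee_fin -expRM_natl ler_expR mulrN lerN2.
rewrite mulrCA ler_pM2l//; have := mu_containing_ge c n r0.
have muD : mu D = (fine (mu D))%:E by rewrite fineK// ge0_fin_numE.
by rewrite -/D muD -(fineK cf) -EFinM lee_fin.
Qed.

(** Space is cut into integer unit cubes, and each of them into (M 2^n)^d cells. By the union bound,
    some cell fails to lie in a single set with probability at most [K * th ^+ n], and the
    hypothesis says that [th < 1]. *)
Lemma uncovered_negligible r : 0 < r ->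
  d%:R * ln 2 < l * fine (mu (cont (cube 0 r) 0)) ->
  P.-negligible [set w | uncovered (Phi w) !=set0].
Proof.
move=> r0 lr; set a := fine _ in lr.
pose A (z : {ffun 'I_d -> int}) := [set w | exists x : 'rV[R]_d,
  (forall i, 0 <= x 0 i - (z i)%:~R / 1%:R <= 1%:R^-1) /\ uncovered (Phi w) x].
apply: (@negligibleS _ _ _ P [set w | exists z, A z w]).
  by move=> w [x ux]; have [z zP] := lattice_point 0 x; exists z, x.
apply: negligible_bigcup_count => z.
(* With this [M], a cell of level n has radius 2^-n/(2M), at most 2^-n r. *)
have [M M0 Mr] : exists2 M : nat, (0 < M)%N & 2^-1 / M%:R <= r.
  have /cvgrPdist_lt/(_ _ r0)[n _ nP] := @cvg_harmonic R.
  exists n.+1 => //; have := nP n (leqnn _).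
  rewrite /harmonic sub0r normrN ger0_norm ?invr_ge0// => /ltW; apply: le_trans.
  by rewrite ler_piMl ?invr_ge0// invf_le1 ?ler1n.
pose zc : 'rV[R]_d := \row_i (z i)%:~R.
pose N n := (M * 2 ^ n)%N.
pose B n (q : {ffun 'I_d -> 'I_(N n)}) : set Omega :=
  vacant (containing (cube (zc + grid R q) (2^-1 ^+ n * r)) (2^-1 ^+ n.+1)).
have mB n q : measurable (B n q).
  apply: measurable_vacant; apply: measurable_containing => //.
  exact: cube_compact.
pose b := expR (- (l * a)).
pose K := M%:R ^+ d * b; pose th := 2 ^+ d * b.
have PB n : (P [set w | exists q, B n q w] <= (K * th ^+ n)%:E)%E.
  apply: le_trans (measure_bigcup_fin_le P (mB n)).2 _.
  apply: (@le_trans _ _ (\sum_(q : {ffun 'I_d -> 'I_(N n)}) (b ^+ n.+1)%:E)%E).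
    by apply: lee_sum => q _; apply: prob_vacant_containing; exact: ltW.
  rewrite sumEFin sumr_const card_ffun !card_ord -[_ *+ _]mulr_natr natrX lee_fin.
  rewrite /N natrM natrX /K /th exprMn_comm; last exact: mulrC.
  rewrite exprS exprMn -exprM mulnC exprM le_eqVlt; apply/orP; left; apply/eqP; ring.
(* An uncovered point spoils a cell at every level, so the intersection over all levels serves as
   the measurable null set. *)
pose C := \bigcap_n [set w | exists q, B n q w].
have mC : measurable C.
  by apply: bigcap_measurable => // n _; exact: (measure_bigcup_fin_le P (mB n)).1.
exists C; split.
- exact: mC.
- pose Q := P C; suff : Q = 0%E by []; have Q1 : (Q <= 1)%E by apply: probability_le1.
  have Q0 : (0 <= Q)%E by exact: measure_ge0.
  have Qf : Q \is a fin_num by rewrite ge0_fin_numE// (le_lt_trans Q1) ?ltry.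
  apply/eqP; rewrite eq_le Q0 andbT leNgt; apply/negP => Qpos.
  have th1 : `|th| < 1.
    rewrite ger0_norm ?mulr_ge0 ?exprn_ge0 ?expR_ge0// /th /b.
    rewrite (_ : 2 ^+ d = expR (d%:R * ln 2)); last by rewrite expRM_natl lnK ?posrE.
    rewrite -expRD -[ltRHS]expR0 ltr_expR; lra.
  have fQ : 0 < fine Q by rewrite fine_gt0// Qpos (le_lt_trans Q1) ?ltry.
  have /cvgrPdist_lt/(_ _ fQ)[n _ nP] := cvg_geometric K th1.
  have := nP n (leqnn _); rewrite /= sub0r normrN => /(le_lt_trans (ler_norm _)).
  apply/negP; rewrite -leNgt -lee_fin fineK//; apply: le_trans (PB n).
  apply: le_measure; rewrite ?inE.
  + exact: mC.
  + exact: (measure_bigcup_fin_le P (mB n)).1.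
  + by apply: bigcap_inf.
move=> w [x [xz ux]] n _ /=.
have N0 : (0 < N n)%N by rewrite muln_gt0 M0 expn_gt0.
have [||q qx] := @grid_cover R d (N n) (x - zc); first by [].
  by move=> i; have := xz i; rewrite !mxE divr1 invr1.
exists q => i G wG [qG _]; apply: ux; exists i, G; split=> //; apply: qG.
move=> j; have := qx j; rewrite !mxE opprD addrA; move/le_trans; apply.
by rewrite /N natrM natrX invfM mulrA mulrC -exprVn ler_pM2l.
Qed.

End process.

(** * Energy of the dyadic grid *)

Section energy.
Variables (R : realType) (d : nat).

(** Lower corners of the dyadic cells, not their centres as in [grid]. *)
Definition dyadic n (q : {ffun 'I_d -> 'I_(2 ^ n)}) : 'rV[R]_d :=
  \row_i ((q i)%:R * 2^-1 ^+ n).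

(* 3 = 1 + 2: a set of diameter < 2^-j hitting two cubes of radii <= 2^-j. *)
Definition close_at n (j : nat) (q p : {ffun 'I_d -> 'I_(2 ^ n)}) : bool :=
  [forall i, `|dyadic q 0 i - dyadic p 0 i| <= 3 * 2^-1 ^+ j].

Lemma dyadic_unit_cube n (q : {ffun 'I_d -> 'I_(2 ^ n)}) : unit_cube (dyadic q).
Proof.
move=> i; rewrite mxE mulr_ge0//= exprVn ler_pdivrMr ?exprn_gt0// mul1r.
by rewrite -natrX ler_nat ltnW.
Qed.

Lemma close_at0 n (q p : {ffun 'I_d -> 'I_(2 ^ n)}) : close_at 0 q p.
Proof.
apply/forallP => i; have /andP[q0 q1] := dyadic_unit_cube q i.
have /andP[p0 p1] := dyadic_unit_cube p i.
by rewrite expr0 ler_norml; apply/andP; split; lra.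
Qed.

Lemma close_at_max n j k (q p : {ffun 'I_d -> 'I_(2 ^ n)}) :
  close_at j q p -> close_at k q p -> close_at (maxn j k) q p.
Proof. by move=> nj nk; case: (leqP j k). Qed.

(** Each coordinate leaves at most 6 2^(n-j) + 1 choices, and [j <= n] turns the 1 into another
    2^(n-j). *)
Lemma card_close_at n j (q : {ffun 'I_d -> 'I_(2 ^ n)}) : (j <= n)%N ->
  \sum_p (close_at j q p)%:R <= (7 * 2 ^+ n * 2^-1 ^+ j : R) ^+ d.
Proof.
move=> jn; have -> : \sum_p (close_at j q p)%:R = #|[pred p | close_at j q p]|%:R :> R.
  rewrite -sum1_card natr_sum [RHS]big_mkcond/=; apply: eq_bigr => p _.
  by rewrite inE; case: close_at.
pose c i : R := (q i)%:R; pose e : R := 3 * 2 ^+ n * 2^-1 ^+ j.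
have n0 : 0 < (2 : R) ^+ n by rewrite exprn_gt0.
have jn1 : 1 <= (2 : R) ^+ n * 2^-1 ^+ j.
  by rewrite exprVn ler_pdivlMr ?exprn_gt0// mul1r ler_weXn2l// ler1n.
apply: (@le_trans _ _ (\prod_i Num.max 0 ((c i + e) - (c i - e) + 1))).
  apply: card_box_le => p /forallP np i; have := np i.
  rewrite !mxE -mulrBl normrM [`|2^-1 ^+ n|]ger0_norm// exprVn ler_pdivrMr//.
  rewrite ler_distlC /c /e => /andP[h1 h2]; apply/andP.
  by split; [apply: le_trans h1|apply: le_trans h2 _]; lra.
rewrite -[X in _ ^+ X](card_ord d) -prodr_const.
apply: ler_prod => i _; rewrite le_max lexx/= ge_max; apply/andP; split.
  by rewrite mulr_ge0// mulr_ge0// ltW.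
rewrite /e; lra.
Qed.

(** If [k] is the last true index, the count is at most k+1 and term [k] alone dominates; [b 0]
    ensures that there is one. A power of a count thus becomes a sum over levels. *)
Lemma expr_count_le (w : R) (b : nat -> bool) n : 1 <= w -> b 0%N ->
  w ^+ (\sum_(k < n.+1) b k) <= \sum_(k < n.+1) (b k)%:R * w ^+ k.+1.
Proof.
move=> w1 b0; elim: n => [|n IH]; first by rewrite !big_ord1 b0 mul1r.
rewrite big_ord_recr [leRHS]big_ord_recr/=; case: (b n.+1); last first.
  by rewrite addn0 mul0r addr0.
rewrite mul1r ler_wpDl//.
  apply: sumr_ge0 => k _; rewrite mulr_ge0// exprn_ge0//; lra.
rewrite ler_weXn2l// addn1 ltnS -[leqRHS]card_ord -sum1_card.
by apply: leq_sum => k _; case: (b k).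
Qed.

Variables (w v s : R).
Hypotheses (w1 : 1 <= w) (s0 : 0 < s) (s1 : s < 1).
Hypotheses (ws : w <= 2 ^+ d * s ^+ 4) (vs : v * s ^+ 2 = 1).

(** With m = max(j, k), the left side is at most (v w 2^-d)^m. Half of the slack s^4 is spent on
    [v]; the remaining s^(2m) is at most s^(j+k), so the double sum over scales is geometric. *)
Lemma scale_weight_le j k :
  v ^+ j * w ^+ k * (2^-1 ^+ maxn j k) ^+ d <= s ^+ j * s ^+ k.
Proof.
set m := maxn j k.
have v1 : 1 <= v.
  rewrite leNgt; apply/negP => v1; move: vs; apply/eqP; rewrite lt_eqF//.
  have s21 : s ^+ 2 <= 1 by rewrite exprn_ile1 ?ltW.
  have s20 : 0 < s ^+ 2 by rewrite exprn_gt0.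
  by apply: lt_le_trans s21; rewrite gtr_pMl.
have v0 : 0 <= v by lra.
have w0 : 0 <= w by exact: le_trans w1.
apply: (@le_trans _ _ ((v * w) ^+ m * (2^-1 ^+ d) ^+ m)).
  rewrite -!exprM [(m * d)%N]mulnC ler_wpM2r ?exprn_ge0// exprMn.
  by rewrite ler_pM ?exprn_ge0// ler_weXn2l// ?leq_maxl ?leq_maxr.
rewrite -exprMn -exprD; apply: (@le_trans _ _ ((s ^+ 2) ^+ m)).
  rewrite lerXn2r ?nnegrE ?mulr_ge0 ?exprn_ge0 ?(ltW s0)//.
  rewrite exprVn ler_pdivrMr ?exprn_gt0//.
  apply: (@le_trans _ _ (v * (2 ^+ d * s ^+ 4))); first by rewrite ler_wpM2l.
  rewrite (_ : v * (2 ^+ d * s ^+ 4) = (v * s ^+ 2) * (s ^+ 2 * 2 ^+ d)).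
    by rewrite vs mul1r.
  ring.
rewrite -exprM ler_wiXn2l ?(ltW s0) ?(ltW s1)//.
by rewrite mul2n -addnn leq_add// ?leq_maxl ?leq_maxr.
Qed.

Lemma geom_sum_le n : \sum_(k < n) s ^+ k <= (1 - s)^-1.
Proof.
have E : (1 - s) * \sum_(k < n) s ^+ k = 1 - s ^+ n.
  by rewrite -opprB mulNr -subrX1 opprB.
rewrite -[leRHS]mul1r ler_pdivlMr ?subr_gt0// mulrC E gerBl.
by rewrite exprn_ge0// ltW.
Qed.

Definition energy_bound : R := w * 7 ^+ d * (1 - s)^-1 ^+ 2.

(** The power of [w] is expanded by [expr_count_le]; a pair close at levels [j] and [k] is close at
    the larger one, where [card_close_at] counts the pairs. *)
Lemma energy_le n :
  \sum_(j < n.+1) \sum_(q : {ffun 'I_d -> 'I_(2 ^ n)}) \sum_p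
    v ^+ j * (close_at j q p)%:R * w ^+ (\sum_(k < n.+1) close_at k q p)
  <= energy_bound * ((2 ^+ n) ^+ d) ^+ 2.
Proof.
have v0 : 0 <= v.
  by rewrite -(@pmulr_lge0 _ (s ^+ 2)) ?exprn_gt0// vs.
have w0 : 0 <= w by exact: le_trans w1.
apply: (@le_trans _ _ (\sum_(j < n.+1) \sum_(k < n.+1)
    w * 7 ^+ d * ((2 ^+ n) ^+ d) ^+ 2 * (s ^+ j * s ^+ k))).
  apply: ler_sum => j _.
  apply: (@le_trans _ _ (\sum_(k < n.+1) \sum_(q : {ffun 'I_d -> 'I_(2 ^ n)}) \sum_p
      v ^+ j * w ^+ k.+1 * (close_at (maxn j k) q p)%:R)).
    rewrite [leRHS]exchange_big/=; apply: ler_sum => q _.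
    rewrite [leRHS]exchange_big/=; apply: ler_sum => p _.
    rewrite -mulrA; under [leRHS]eq_bigr do rewrite -mulrA.
    rewrite -mulr_sumr ler_wpM2l ?exprn_ge0//.
    case njE : (close_at j q p); last first.
      by rewrite mul0r; apply: sumr_ge0 => k _; rewrite mulr_ge0 ?exprn_ge0.
    rewrite mul1r.
    apply: le_trans (@expr_count_le w (fun k => close_at k q p) n w1 _) _.
      exact: close_at0.
    apply: ler_sum => k _; rewrite mulrC ler_wpM2l ?exprn_ge0// ler_nat.
    by case nkE : (close_at k q p) => //; rewrite close_at_max.
  apply: ler_sum => k _.
  apply: (@le_trans _ _ (\sum_(q : {ffun 'I_d -> 'I_(2 ^ n)})
      v ^+ j * w ^+ k.+1 * (7 * 2 ^+ n * 2^-1 ^+ maxn j k) ^+ d)).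
    apply: ler_sum => q _; rewrite -mulr_sumr ler_wpM2l ?mulr_ge0 ?exprn_ge0//.
    by apply: card_close_at; rewrite geq_max; apply/andP; split; rewrite -ltnS.
  rewrite sumr_const card_ffun !card_ord -[_ *+ _]mulr_natr natrX natrX.
  apply: le_trans (ler_wpM2l _ (scale_weight_le j k)); last first.
    by rewrite !mulr_ge0 ?exprn_ge0.
  rewrite le_eqVlt; apply/orP; left; apply/eqP; rewrite !exprMn exprS; ring.
under eq_bigr do rewrite -mulr_sumr -mulr_sumr.
rewrite -mulr_sumr -mulr_suml /energy_bound.
rewrite [leRHS](_ : _ = w * 7 ^+ d * ((2 ^+ n) ^+ d) ^+ 2 * (1 - s)^-1 ^+ 2);
  last by ring.
rewrite ler_wpM2l ?mulr_ge0 ?exprn_ge0// [leRHS]expr2.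
by rewrite ler_pM ?geom_sum_le//; apply: sumr_ge0 => k _; rewrite exprn_ge0 ?ltW.
Qed.

End energy.

(** A bound of Paley-Zygmund type. With c = 4C, integrating X <= 1/2 + c 1_E + Y/c gives 1 <= 1/2 +
    4C P(E) + 1/4. *)
Lemma prob_second_moment (dO : measure_display) (Omega : measurableType dO)
    (R : realType) (P : probability Omega R) (X Y : Omega -> R) (C : R) :
  measurable_fun setT X -> measurable_fun setT Y ->
  (forall x, 0 <= X x) -> (forall x, X x ^+ 2 <= Y x) ->
  (\int[P]_x (X x)%:E = 1)%E -> (\int[P]_x (Y x)%:E <= C%:E)%E -> 0 < C ->
  let E := [set x | 2^-1 <= X x /\ Y x <= (4 * C) ^+ 2] in
  measurable E /\ ((16 * C)^-1%:E <= P E)%E.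
Proof.
move=> mX mY X0 XY EX EY C0 E.
have Y0 x : 0 <= Y x by apply: le_trans (XY x); exact: sqr_ge0.
have mE : measurable E.
  have -> : E = X @^-1` `[2^-1, +oo[%classic `&` Y @^-1` `]-oo, (4 * C) ^+ 2]%classic.
    by apply/seteqP; split=> x /=; rewrite !in_itv/= andbT.
  apply: measurableI.
    by rewrite -[X in measurable X]setTI; exact: mX.
  by rewrite -[X in measurable X]setTI; exact: mY.
split=> //; pose c := 4 * C; have c0 : 0 < c by rewrite mulr_gt0.
have mI : measurable_fun setT (\1_E : Omega -> R) by exact: measurable_indic.
(* If [Y x > c ^+ 2] then [X x <= Y x / c], by [X x ^+ 2 <= Y x]. *)
have pointwise x : X x <= 2^-1 + (c * \1_E x + c^-1 * Y x).
  have [Xs|Xl] := ltP (X x) 2^-1.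
    rewrite (le_trans (ltW Xs))// lerDl addr_ge0// mulr_ge0// ltW//.
    by rewrite invr_gt0.
  have [Ys|Yl] := leP (Y x) (c ^+ 2).
    rewrite indicE mem_set//= mulr1 (@le_trans _ _ c)//.
      by move: (le_trans (XY x) Ys); rewrite ler_pXn2r ?nnegrE ?X0 ?(ltW c0).
    by rewrite addrCA lerDl addr_ge0// mulr_ge0// invr_ge0 ltW.
  apply: (@le_trans _ _ (c^-1 * Y x)).
    rewrite ler_pdivlMl//; have [Xc|cX] := leP (X x) c.
      by apply: le_trans (ltW Yl); rewrite expr2 ler_pM2l.
    by apply: le_trans (XY x); rewrite expr2 ler_wpM2r// ltW.
  by rewrite addrA lerDr addr_ge0// mulr_ge0// ltW.
have : (1 <= 2^-1%:E + (c%:E * P E + c^-1%:E * \int[P]_x (Y x)%:E))%E.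
  rewrite -EX.
  apply: (@le_trans _ _ (\int[P]_x
      (2^-1%:E + (c%:E * (\1_E x)%:E + c^-1%:E * (Y x)%:E)))%E).
    apply: ge0_le_integral => //.
    - by move=> x _; rewrite lee_fin.
    - exact/measurable_EFinP.
    - under eq_fun do rewrite -!EFinM -!EFinD.
      apply/measurable_EFinP; apply: measurable_funD => //.
      by apply: measurable_funD; apply: measurable_funM.
    - by move=> x _; rewrite -!EFinM -!EFinD lee_fin.
  rewrite ge0_integralD//; first last.
  - under eq_fun do rewrite -!EFinM -!EFinD.
    apply/measurable_EFinP.
    by apply: measurable_funD; apply: measurable_funM.
  - move=> x _; rewrite -!EFinM -!EFinD lee_fin addr_ge0// mulr_ge0//.
      by rewrite ltW.
    by rewrite invr_ge0 ltW.
  rewrite integral_cst//= probability_setT mule1.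
  apply: leeD2l; rewrite ge0_integralD//; first last.
  - under eq_fun do rewrite -!EFinM.
    by apply/measurable_EFinP; apply: measurable_funM.
  - by move=> x _; rewrite -EFinM lee_fin mulr_ge0// invr_ge0 ltW.
  - under eq_fun do rewrite -!EFinM.
    by apply/measurable_EFinP; apply: measurable_funM.
  - by move=> x _; rewrite -EFinM lee_fin mulr_ge0// ltW.
  rewrite !ge0_integralZl_EFin//; last 5 first.
  - by move=> x _; rewrite lee_fin.
  - exact/measurable_EFinP.
  - by rewrite invr_ge0 ltW.
  - exact/measurable_EFinP.
  - by rewrite ltW.
  by rewrite integral_indic// setIT.
have PEf : P E \is a fin_num by exact: fin_num_measure.
move=> H; have {H EY} : (1 <= 2^-1%:E + (c%:E * P E + c^-1%:E * C%:E))%E.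
  apply: le_trans H _; apply: leeD2l; apply: leeD2l.
  by rewrite lee_wpmul2l// lee_fin invr_ge0 ltW.
have E4 : c^-1 * C = 4^-1 by rewrite /c invfM -mulrA mulVf ?mulr1// gt_eqF.
rewrite -(fineK PEf) -!EFinM -!EFinD !lee_fin E4 /c => H.
rewrite -[leLHS]mul1r ler_pdivrMr ?mulr_gt0//.
by move: H; set p := fine _ => H; nra.
Qed.

(** * Survival of grid points *)

Section survival.
Variables (R : realType) (d : nat).
Local Notation GG := (small_set R d).
Variables (F : set (set GG)) (F_suitable : suitable F).
Variable mu : {measure set (g_sigma_algebraType F) -> \bar R}.
Hypothesis mu_translation : translation_invariant F mu.
Hypothesis mu_scale : semi_scale_invariant F mu.
Hypothesis mu_hitting : forall (A : set 'rV[R]_d) (delta : R),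
  bounded_set A -> 0 < delta -> (mu (hitting A delta) < +oo)%E.
Variables (dO : measure_display) (Omega : measurableType dO).
Variables (P : probability Omega R) (Phi : Omega -> configuration R d) (l : R).
Hypothesis l_gt0 : 0 < l.
Hypothesis Phi_poisson : poisson_process F (fun D => (l%:E * mu D)%E) P Phi.
Variable r : R.
Hypothesis r_le1 : r <= 1.

Local Notation grid_pt n := {ffun 'I_d -> 'I_(2 ^ n)}.
Let meas (D : set GG) := measurable (D : set (g_sigma_algebraType F)).
Let h := fine (mu (hit (cube 0 r) 0)).
Let w := expR (l * h).

(** The radius shrinks with the band, so that every band contributes the same mass [h]. *)
Definition obstacles n (q : grid_pt n) : set GG :=
  \big[setU/set0]_(k < n.+1) hit (cube (dyadic R q) (2^-1 ^+ k * r)) k.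

Definition alive n (q : grid_pt n) : set Omega :=
  vacant Phi (obstacles q).

Lemma obstaclesP n (q : grid_pt n) G : obstacles q G <->
  exists2 k, (k <= n)%N & hit (cube (dyadic R q) (2^-1 ^+ k * r)) k G.
Proof.
rewrite /obstacles -bigcup_seq; split=> [[k _ kG]|[k kn kG]].
  by exists k => //; rewrite -ltnS.
by exists (inord k) => /=; rewrite ?mem_index_enum ?inordK.
Qed.

Lemma mu_hit0_fineE : mu (hit (cube 0 r) 0) = h%:E.
Proof.
by rewrite fineK// ge0_fin_numE//; apply: mu_hit_fin => //; exact: cube_bounded.
Qed.

Lemma measurable_obstacles n (q : grid_pt n) : meas (obstacles q).
Proof.
apply: bigsetU_measurable => k _; apply: measurable_hit => //; exact: cube_bounded.
Qed.

Lemma mu_obstacles n (q : grid_pt n) :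
  mu (obstacles q) = (n.+1%:R * h)%:E.
Proof.
rewrite measure_bigsetU_ord.
- rewrite (eq_bigr (fun=> h%:E)).
    by rewrite sumEFin sumr_const card_ord mulr_natl.
  by move=> k _; rewrite -mu_hit0_fineE; exact: mu_hit_cube.
- by move=> k; apply: measurable_hit => //; exact: cube_bounded.
- by move=> i j _ _ [G [[_ bi] [_ bj]]]; apply: val_inj; exact: band_inj bi bj.
Qed.

Lemma hit_hit_close n k (q p : grid_pt n) G :
  hit (cube (dyadic R q) (2^-1 ^+ k * r)) k G ->
  hit (cube (dyadic R p) (2^-1 ^+ k * r)) k G -> close_at R k q p.
Proof.
move=> [[x [Gx qx]] bG] [[y [Gy py]] _]; apply/forallP => i.
have /ltW xy : `|(x - y) 0 i| < 2^-1 ^+ k.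
  apply: le_lt_trans (coord_le_euclid (x - y) i) _; rewrite -lte_fin.
  by apply: le_lt_trans (euclid_le_diam Gx Gy) _; case: bG.
have r1 : 2^-1 ^+ k * r <= 2^-1 ^+ k by rewrite ler_piMr// ltW ?exp_half_gt0.
have := le_trans (qx i) r1; have := le_trans (py i) r1; move: xy.
rewrite !mxE; move: (_ ^+ k) (_ * _ : R) (_ * _ : R) => u a b.
rewrite !ler_norml => /andP[? ?] /andP[? ?] /andP[? ?].
by apply/andP; split; lra.
Qed.

(** Bands are disjoint, so a common obstacle hits both cubes at one level. Only levels at which the
    two points are close contribute, each at most [h]. *)
Lemma mu_obstaclesI n (q p : grid_pt n) :
  (mu (obstacles q `&` obstacles p) <=
   ((\sum_(k < n.+1) close_at R k q p)%:R * h)%:E)%E.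
Proof.
pose H k := hit (cube (dyadic R q) (2^-1 ^+ k * r)) k.
pose H' k := hit (cube (dyadic R p) (2^-1 ^+ k * r)) k.
have mH k : meas (H k) by apply: measurable_hit => //; exact: cube_bounded.
have mH' k : meas (H' k) by apply: measurable_hit => //; exact: cube_bounded.
pose B (k : 'I_n.+1) : set (g_sigma_algebraType F) := H k `&` H' k.
have mB k : measurable (B k) by apply: measurableI; [exact: mH|exact: mH'].
have -> : obstacles q `&` obstacles p = \big[setU/set0]_(k < n.+1) B k.
  rewrite -bigcup_seq; apply/seteqP; split=> G.
    move=> [/obstaclesP[k kn qG] /obstaclesP[j jn pG]].
    have kj : k = j by exact: band_inj qG.2 pG.2.
    subst j; exists (inord k) => /=; first by rewrite mem_index_enum.
    by rewrite /B inordK.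
  move=> [k _ [qG pG]].
  by split; apply/obstaclesP; exists k => //; rewrite -ltnS.
rewrite measure_bigsetU_ord//; last first.
  by move=> i j _ _ [G [[[_ bi] _] [[_ bj] _]]]; apply: val_inj; exact: band_inj bi bj.
rewrite natr_sum mulr_suml -sumEFin; apply: lee_sum => k _.
case nE : (close_at R k q p).
  rewrite mul1r -mu_hit0_fineE -(mu_hit_cube F_suitable mu_translation
    mu_scale mu_hitting (dyadic R q) r k).
  by apply: le_measure; rewrite ?inE//; [exact: mH|exact: subIsetl].
rewrite mul0r (_ : B k = set0) ?measure0//.
apply/seteqP; split=> // G [qG pG]; have := hit_hit_close qG pG.
by rewrite nE.
Qed.

Lemma h_ge0 : 0 <= h. Proof. exact: fine_ge0. Qed.

Lemma measurable_alive n (q : grid_pt n) : measurable (alive q).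
Proof.
exact: (measurable_vacant F_suitable Phi_poisson (measurable_obstacles q)).
Qed.

Lemma prob_alive n (q : grid_pt n) :
  P (alive q) = (w ^- n.+1)%:E.
Proof.
rewrite (prob_vacant F_suitable l_gt0 Phi_poisson (measurable_obstacles q)); last first.
  by rewrite mu_obstacles ltry.
by rewrite mu_obstacles/= mulrCA expRN expRM_natl.
Qed.

(** Both points are alive when the union of their obstacles is vacant; its mass is 2(n+1)h minus
    that of the intersection. *)
Lemma prob_aliveI n (q p : grid_pt n) :
  (P (alive q `&` alive p) <=
   (w ^+ (\sum_(k < n.+1) close_at R k q p) * (w ^- n.+1) ^+ 2)%:E)%E.
Proof.
have -> : alive q `&` alive p = vacant Phi (obstacles q `|` obstacles p).
  apply/seteqP; split=> [t [vq vp] i G tG|t v].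
    by move=> [qG|pG]; [exact: vq tG qG|exact: vp tG pG].
  by split=> i G tG DG; apply: (v i G tG); [left|right].
have mO := measurable_obstacles.
have fO (t : grid_pt n) : (mu (obstacles t) < +oo)%E.
  by rewrite mu_obstacles ltry.
have mI : meas (obstacles q `&` obstacles p) by apply: measurableI; exact: mO.
have If : mu (obstacles q `&` obstacles p) \is a fin_num.
  by rewrite ge0_fin_numE// (le_lt_trans (mu_obstaclesI q p))// ltry.
have UE : (mu (obstacles q `|` obstacles p) = (n.+1%:R * h + n.+1%:R * h -
    fine (mu (obstacles q `&` obstacles p)))%:E)%E.
  rewrite EFinB EFinD fineK// -{1}(mu_obstacles q) -(mu_obstacles p).
  by apply: measureUfinr; [exact: mO|exact: mO|exact: fO].
rewrite (prob_vacant F_suitable l_gt0 Phi_poisson); last 2 first.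
- by apply: measurableU; exact: mO.
- by rewrite UE ltry.
rewrite UE/= lee_fin -exprVn -exprM -expRN /w -!expRM_natl -expRD ler_expR.
have := mu_obstaclesI q p; rewrite -(fineK If) lee_fin => Ih.
have := ler_wpM2l (ltW l_gt0) Ih; rewrite natrM; lra.
Qed.

Variables (v s : R).
Hypotheses (s0 : 0 < s) (s1 : s < 1).
Hypotheses (ws : w <= 2 ^+ d * s ^+ 4) (vs : v * s ^+ 2 = 1).

(** Inverse number of grid points times inverse survival probability, so that [mass] has mean 1. *)
Definition weight n : R := ((2 ^+ n) ^+ d)^-1 * w ^+ n.+1.

Definition mass n (o : Omega) : R :=
  \sum_(q : grid_pt n) weight n * \1_(alive q) o.

(** A discrete energy: pairs of alive points close at scale [j] are charged v^j, where v = s^-2 > 1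
    penalises concentration. Scale and pair form a single index so that [integral_sum_indic]
    applies. *)
Definition energy n (o : Omega) : R :=
  \sum_(t : 'I_n.+1 * (grid_pt n * grid_pt n))
    (v ^+ t.1 * (close_at R t.1 t.2.1 t.2.2)%:R * weight n ^+ 2) *
    \1_(alive t.2.1 `&` alive t.2.2) o.

Lemma w_ge1 : 1 <= w.
Proof. by rewrite -expR0 ler_expR mulr_ge0 ?h_ge0// ltW. Qed.

Lemma weight_gt0 n : 0 < weight n.
Proof. by rewrite mulr_gt0 ?invr_gt0 ?exprn_gt0// expR_gt0. Qed.

Lemma v_gt0 : 0 < v.
Proof.
by rewrite -(@pmulr_lgt0 _ (s ^+ 2)) ?vs// exprn_gt0.
Qed.

Lemma measurable_mass n : measurable_fun setT (mass n).
Proof.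
apply: measurable_sum => q; apply: measurable_funM => //.
by apply: measurable_indic; exact: measurable_alive.
Qed.

Lemma measurable_energy n : measurable_fun setT (energy n).
Proof.
apply: measurable_sum => q; apply: measurable_funM => //.
by apply: measurable_indic; apply: measurableI; exact: measurable_alive.
Qed.

Lemma mass_ge0 n o : 0 <= mass n o.
Proof. by apply: sumr_ge0 => q _; rewrite mulr_ge0 ?(ltW (weight_gt0 n)). Qed.

(** The energy has nonnegative terms, and those of scale [j] with both points in [S] already give
    the left side. The whole grid at scale 0 yields [mass_sqr_le]; small cubes yield the spreading
    of the mass. *)
Lemma mass_sqr_le_energy n (j : 'I_n.+1) (S : pred (grid_pt n)) o :
  (forall q p, S q -> S p -> close_at R j q p) ->
  v ^+ j * (\sum_(q | S q) weight n * \1_(alive q) o) ^+ 2 <= energy n o.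
Proof.
move=> nS; rewrite /energy
  -(pair_bigA _ (fun (a : 'I_n.+1) (b : grid_pt n * grid_pt n) =>
    (v ^+ a * (close_at R a b.1 b.2)%:R * weight n ^+ 2) *
    \1_(alive b.1 `&` alive b.2) o))/=.
have W0 := ltW (weight_gt0 n); have V0 := ltW v_gt0.
rewrite (bigD1 j)//= -[leLHS]addr0 lerD//; last first.
  apply: sumr_ge0 => a _; apply: sumr_ge0 => b _.
  by rewrite !mulr_ge0 ?exprn_ge0// expR_ge0.
rewrite -(pair_bigA _ (fun (q p : grid_pt n) =>
    (v ^+ j * (close_at R j q p)%:R * weight n ^+ 2) *
    \1_(alive q `&` alive p) o))/=.
rewrite expr2 big_distrlr/= mulr_sumr big_mkcond/=; apply: ler_sum => q _.
have nonneg p : 0 <= v ^+ j * (close_at R j q p)%:R * weight n ^+ 2 *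
    \1_(alive q `&` alive p) o.
  by rewrite !mulr_ge0 ?exprn_ge0// expR_ge0.
case: ifPn => Sq; last exact: sumr_ge0.
rewrite mulr_sumr big_mkcond/=; apply: ler_sum => p _.
case: ifPn => // Sp; rewrite nS// mulr1 indicI/=.
by rewrite le_eqVlt; apply/orP; left; apply/eqP; ring.
Qed.

Lemma mass_sqr_le n o : mass n o ^+ 2 <= energy n o.
Proof.
have := @mass_sqr_le_energy n ord0 xpredT o (fun q p _ _ => close_at0 R q p).
by rewrite expr0 mul1r.
Qed.

Lemma integral_mass n : (\int[P]_o (mass n o)%:E = 1)%E.
Proof.
rewrite (integral_sum_indic P measurableT (fun=> ltW (weight_gt0 n))
  (@measurable_alive n)).
rewrite (eq_bigr (fun=> (weight n * w ^- n.+1)%:E)); last first.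
  by move=> q _; rewrite setIT [RHS]EFinM -(prob_alive q).
rewrite sumEFin sumr_const card_ffun !card_ord -[_ *+ _]mulr_natr !natrX.
rewrite /weight -[_ * w ^+ _ * _]mulrA divff ?expf_neq0 ?gt_eqF ?expR_gt0//.
by rewrite mulr1 mulVf// expf_neq0// expf_neq0.
Qed.

Lemma integral_energy n :
  (\int[P]_o (energy n o)%:E <= (energy_bound d w s)%:E)%E.
Proof.
have W0 := ltW (weight_gt0 n); have V0 := ltW v_gt0.
rewrite integral_sum_indic//; last 2 first.
- by move=> t; rewrite !mulr_ge0 ?exprn_ge0 ?expR_ge0.
- by move=> t; apply: measurableI; exact: measurable_alive.
pose N2 : R := ((2 ^+ n) ^+ d) ^- 2.
apply: (@le_trans _ _ (\sum_(t : 'I_n.+1 * (grid_pt n * grid_pt n))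
   (N2 * (v ^+ t.1 * (close_at R t.1 t.2.1 t.2.2)%:R *
     w ^+ (\sum_(k < n.+1) close_at R k t.2.1 t.2.2)))%:E)%E).
  apply: lee_sum => t _; rewrite setIT.
  have c0 : (0 <= (v ^+ t.1 * (close_at R t.1 t.2.1 t.2.2)%:R * weight n ^+ 2)%:E)%E.
    by rewrite lee_fin !mulr_ge0 ?exprn_ge0 ?expR_ge0.
  apply: le_trans (lee_wpmul2l c0 (prob_aliveI t.2.1 t.2.2)) _.
  rewrite -EFinM lee_fin le_eqVlt; apply/orP; left; apply/eqP.
  have wn : w ^+ n.+1 != 0 by rewrite expf_neq0// gt_eqF// expR_gt0.
  have An : (2 ^+ n) ^+ d != 0 :> R by rewrite !expf_neq0.
  rewrite /weight /N2; move: wn An; move: (w ^+ n.+1) ((2 ^+ n) ^+ d : R).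
  move: (v ^+ _ * _%:R) (w ^+ _) => u u' B A wn An.
  by field; rewrite wn An.
rewrite sumEFin lee_fin -mulr_sumr ler_pdivrMl ?exprn_gt0// mulrC.
rewrite -(pair_bigA _ (fun (a : 'I_n.+1) (b : grid_pt n * grid_pt n) =>
     v ^+ a * (close_at R a b.1 b.2)%:R *
     w ^+ (\sum_(k < n.+1) close_at R k b.1 b.2)))/=.
under eq_bigr do rewrite -(pair_bigA _ (fun (q p : grid_pt n) =>
     v ^+ _ * (close_at R _ q p)%:R *
     w ^+ (\sum_(k < n.+1) close_at R k q p)))/=.
by apply: energy_le => //; exact: w_ge1.
Qed.

Lemma energy_bound_gt0 : 0 < energy_bound d w s.
Proof.
by rewrite /energy_bound !mulr_gt0 ?expR_gt0 ?exprn_gt0 ?invr_gt0 ?subr_gt0.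
Qed.

Definition charged n : set Omega :=
  [set o | 2^-1 <= mass n o /\ energy n o <= (4 * energy_bound d w s) ^+ 2].

Lemma prob_charged n : measurable (charged n) /\
  ((16 * energy_bound d w s)^-1%:E <= P (charged n))%E.
Proof.
apply: prob_second_moment.
- exact: measurable_mass.
- exact: measurable_energy.
- exact: mass_ge0.
- exact: mass_sqr_le.
- exact: integral_mass.
- exact: integral_energy.
- exact: energy_bound_gt0.
Qed.

(** The bound of [prob_charged] does not depend on [n], so it passes to the decreasing unions of the
    tails and to their limit. *)
Lemma limsup_charged_gt0 : (0 < P (lim_sup_set charged))%E.
Proof.
have mE n : measurable (charged n) := (prob_charged n).1.
apply: (@lt_le_trans _ _ (16 * energy_bound d w s)^-1%:E).
  by rewrite lte_fin invr_gt0 mulr_gt0// energy_bound_gt0.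
have fin : (P (\bigcup_(k >= 0) charged k) < +oo)%E.
  by rewrite (le_lt_trans (probability_le1 _ _)) ?ltry//; apply: bigcup_measurable.
have cv := lim_sup_set_cvg P charged mE fin.
rewrite -(cvg_lim _ cv)//; apply: lime_ge.
  by apply/cvg_ex; eexists; exact: cv.
apply: nearW => n; apply: le_trans (prob_charged n).2 _.
apply: le_measure; rewrite ?inE//; first by apply: bigcup_measurable.
by move=> o no; exists n => //=.
Qed.

End survival.

(** * From alive grid points to an uncovered point *)

Lemma diam0_eq (R : realType) (d : nat) (A : set 'rV[R]_d) x y :
  diam A = 0%E -> A x -> A y -> x = y.
Proof.
move=> A0 Ax Ay; apply/rowP => i; apply/eqP; rewrite -subr_eq0 -normr_le0.
have := euclid_le_diam Ax Ay; rewrite A0 lee_fin; apply: le_trans.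
by have := coord_le_euclid (x - y) i; rewrite !mxE.
Qed.

Lemma diam_gt0_band (R : realType) (d : nat) (G : small_set R d) :
  (0 < diam (shape G))%E -> exists k, band k G.
Proof.
move=> G0; have [n n2] : exists n : nat, ((2^-1 ^+ n)%:E <= diam (shape G))%E.
  have Gf : diam (shape G) \is a fin_num.
    by rewrite ge0_fin_numE ?diam_ge0// (lt_trans (svalP G)) ?ltry.
  have e0 : 0 < fine (diam (shape G)) by rewrite fine_gt0// G0 ltey_eq Gf.
  have h1 : `|2^-1 : R| < 1 by rewrite ger0_norm//; lra.
  have /cvgrPdist_lt/(_ _ e0)[n _ nP] := cvg_geometric 1 h1.
  exists n; rewrite -(fineK Gf) lee_fin; have := nP n (leqnn _).
  by rewrite /= mul1r sub0r normrN ger0_norm// => /ltW.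
by have [k _ bk] := bandP n2; exists k.
Qed.

Section nonempty.
Variables (R : realType) (d : nat).
Local Notation GG := (small_set R d).
Variables (F : set (set GG)) (mu : {measure set (g_sigma_algebraType F) -> \bar R}).
Variables (dO : measure_display) (Omega : measurableType dO).
Variables (Phi : Omega -> configuration R d) (l r v s : R).
Hypotheses (r_gt0 : 0 < r) (s0 : 0 < s) (s1 : s < 1) (vs : v * s ^+ 2 = 1).
Let w := expR (l * fine (mu (hit (cube 0 r) 0))).
Local Notation grid_pt n := {ffun 'I_d -> 'I_(2 ^ n)}.

(** Points of one cube of radius 2^-j are pairwise close at scale [j], so the bounded energy
    controls v^j times the square of their mass; v^-1 = s^2 gives the factor s^j. *)
Lemma mass_ball_le n j (x : 'rV[R]_d) o : (j <= n)%N ->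
  charged mu Phi l r v s n o ->
  \sum_(q : grid_pt n | `[< cube x (2^-1 ^+ j) (dyadic R q) >])
    weight mu l r n * \1_(alive Phi r q) o <= 4 * energy_bound d w s * s ^+ j.
Proof.
move=> jn [_ En]; pose S (q : grid_pt n) := `[< cube x (2^-1 ^+ j) (dyadic R q) >].
have nS q p : S q -> S p -> close_at R j q p.
  move=> /asboolP qx /asboolP px; apply/forallP => i.
  have := qx i; have := px i; have := exp_half_gt0 R j.
  move: (_ ^+ j) => e e0; rewrite !ler_norml => /andP[? ?] /andP[? ?].
  by apply/andP; split; lra.
have jn' : (j < n.+1)%N by [].
have := @mass_sqr_le_energy R d F mu dO Omega Phi l r v s s0 vs n (Ordinal jn') S o nS.
move=> /le_trans/(_ En) /=; rewrite /S; set m := \sum_(q | _) _ => H.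
have C0 : 0 <= 4 * energy_bound d w s.
  by rewrite mulr_ge0 ?ltW// energy_bound_gt0.
have C1 : 0 <= 4 * energy_bound d w s * s ^+ j.
  by rewrite mulr_ge0// exprn_ge0// ltW.
have [m0|m0] := leP m 0; first exact: le_trans m0 C1.
rewrite -(@ler_pXn2r _ 2)// ?nnegrE ?(ltW m0)//.
have s2 : 0 <= (s ^+ j) ^+ 2 by rewrite exprn_ge0// exprn_ge0// ltW.
rewrite exprMn; apply: le_trans (ler_wpM2r s2 H).
by rewrite mulrAC -exprM mulnC exprM -exprMn vs expr1n mul1r.
Qed.

(** The forbidden cubes carry mass at most the sum of 2^-(i+2) over [i <= n], which is below 1/2, so
    they cannot hold all alive points. *)
Lemma alive_avoiding (x : nat -> 'rV[R]_d) (j : nat -> nat) n o :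
  (forall i, (i <= j i)%N) ->
  (forall i, 4 * energy_bound d w s * s ^+ j i <= 2^-1 ^+ i.+2) ->
  charged mu Phi l r v s n o ->
  exists q : grid_pt n, alive Phi r q o /\
    forall i, (j i <= n)%N -> ~ cube (x i) (2^-1 ^+ j i) (dyadic R q).
Proof.
move=> ij js Cn; apply: contrapT => nq.
have W0 := ltW (weight_gt0 mu l r n).
suff : mass mu Phi l r n o < 2^-1 by rewrite ltNge; case: (Cn) => ->.
apply: (@le_lt_trans _ _ (\sum_(i < n.+1) (2^-1 : R) ^+ i.+2)); last first.
  have E (m : nat) : \sum_(k < m) (2^-1 : R) ^+ k.+2 = 2^-1 - 2^-1 ^+ m.+1.
    elim: m => [|m IH]; first by rewrite big_ord0 expr1 subrr.
    by rewrite big_ord_recr/= IH (exprS _ m.+1); lra.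
  by rewrite E gtrBl exp_half_gt0.
apply: (@le_trans _ _ (\sum_(i < n.+1) \sum_(q : grid_pt n |
   (j i <= n)%N && `[< cube (x i) (2^-1 ^+ j i) (dyadic R q) >])
    weight mu l r n * \1_(alive Phi r q) o)).
  under [leRHS]eq_bigr do rewrite big_mkcond/=.
  rewrite exchange_big/=; apply: ler_sum => q _.
  have nonneg (i : 'I_n.+1) :
      0 <= (if (j i <= n)%N && `[< cube (x i) (2^-1 ^+ j i) (dyadic R q) >]
       then weight mu l r n * \1_(alive Phi r q) o else 0).
    by case: ifP => // _; rewrite mulr_ge0.
  have [aq|naq] := pselect (alive Phi r q o); last first.
    rewrite [leLHS](_ : _ = 0); first by apply: sumr_ge0 => i _; exact: nonneg.
    by rewrite indicE memNset// mulr0.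
  have [i [jin qi]] : exists i, (j i <= n)%N /\ cube (x i) (2^-1 ^+ j i) (dyadic R q).
    apply: contrapT => H; apply: nq; exists q; split=> // i jin qi.
    by apply: H; exists i.
  (* Here [i <= j i] makes the finite sum see every cube active at level [n]. *)
  have iin : (i < n.+1)%N by rewrite ltnS (leq_trans (ij i)).
  rewrite (bigD1 (Ordinal iin))//= jin asboolT//= lerDl.
  by apply: sumr_ge0 => k _; exact: nonneg.
apply: ler_sum => i _; have [jin|jin] := boolP (j i <= n)%N; last first.
  by rewrite big_pred0// exprn_ge0.
exact: le_trans (mass_ball_le _ jin Cn) (js i).
Qed.

(** Alive points from arbitrarily high charged levels cluster in the unit cube. Each set of the
    process excludes a neighbourhood condition that holds for all late points, so the cluster point
    belongs to none. *)
Lemma charged_uncovered o : lim_sup_set (charged mu Phi l r v s) o ->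
  uncovered (Phi o) !=set0.
Proof.
move=> lim; set K := 4 * energy_bound d w s.
have K0 : 0 < K by rewrite mulr_gt0// energy_bound_gt0.
(* [x i] is the only point of the set of index [i] if that set is a singleton; otherwise the value 0
   is a dummy. *)
have /choice[x xP] i : exists x : 'rV[R]_d, forall G y, Phi o i = Some G ->
    diam (shape G) = 0%E -> shape G y -> y = x.
  have [[G [GE G0 [y Gy]]]|H] := pselect (exists G, [/\ Phi o i = Some G,
      diam (shape G) = 0%E & shape G !=set0]).
    exists y => G' z; rewrite GE => -[<-] _ Gz; exact: diam0_eq G0 Gz Gy.
  exists 0 => G y GE G0 Gy; exfalso; apply: H; exists G; split=> //.
  by exists y.
have /choice[j jP] i : exists j, (i <= j)%N /\ K * s ^+ j <= 2^-1 ^+ i.+2.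
  have e0 := exp_half_gt0 R i.+2.
  have h1 : `|s| < 1 by rewrite ger0_norm// ltW.
  have /cvgrPdist_lt/(_ _ e0)[n _ nP] := cvg_geometric K h1.
  exists (maxn i n); split; first exact: leq_maxl.
  have := nP (maxn i n) (leq_maxr i n); rewrite /= sub0r normrN.
  by move=> /(le_lt_trans (ler_norm _))/ltW.
have /choice[N NP] m : exists n, (m <= n)%N /\ charged mu Phi l r v s n o.
  by have [n /= mn Cn] := lim m I; exists n.
(* Only bands [k <= m] and cubes with [j i <= m] are controlled by [u m], so each constraint holds
   from some [m] on. *)
have /choice[u uP] m : exists y : 'rV[R]_d, [/\ unit_cube y,
    forall k i G, (k <= m)%N -> Phi o i = Some G -> band k G ->
      ~ (shape G `&` cube y (2^-1 ^+ k * r) !=set0) &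
    forall i, (j i <= m)%N -> ~ cube (x i) (2^-1 ^+ j i) y].
  have [mN CN] := NP m.
  have [q [aq qx]] := @alive_avoiding x j (N m) o (fun i => (jP i).1)
    (fun i => (jP i).2) CN.
  exists (dyadic R q); split=> [|k i G km iG bG Gq|i jim].
  - exact: dyadic_unit_cube.
  - apply: (aq i G iG); apply/obstaclesP; exists k; first exact: leq_trans mN.
    by split.
  - by apply: qx; exact: leq_trans mN.
have [|y [_ yu]] := @unit_cube_compact R d (u @ \oo) _.
  by exists 0%N => // m _; have [] := uP m.
have meets (e : R) (m : nat) : 0 < e -> exists2 n, (m <= n)%N & ball y e (u n).
  move=> e0; have [||_ [/= [n mn <-] yn]] := yu (u @` [set n | (m <= n)%N]) (ball y e).
  - by exists m => // n mn; exists n.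
  - exact: nbhsx_ballx.
  - by exists n.
have ballE e z i : ball y e z -> `|y 0 i - z 0 i| < e.
  by case=> _ /(_ 0 i); rewrite -ball_normE.
exists y => -[i [G [iG Gy]]].
(* A set of diameter 0 forces [y = x i], yet late points stay out of a fixed cube around [x i]. A
   set in band [k] would hit the cube of radius 2^-k r around a late point close to [y]. *)
have := diam_ge0 (shape G); rewrite le_eqVlt => /orP[/eqP/esym G0|/diam_gt0_band[k bG]].
  have [n jn yn] := meets (2^-1 ^+ j i) (j i) (exp_half_gt0 R (j i)).
  have [_ _ /(_ i jn)] := uP n; apply => a.
  by rewrite -(xP i G y iG G0 Gy) distrC ltW// ballE.
have e0 : 0 < 2^-1 ^+ k * r by rewrite mulr_gt0// exp_half_gt0.
have [n kn yn] := meets (2^-1 ^+ k * r) k e0.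
have [_ /(_ k i G kn iG bG) + _] := uP n; apply.
by exists y; split=> // a; rewrite ltW// ballE.
Qed.

End nonempty.

(** * The critical value *)

Section critical.
Variables (R : realType) (d : nat).
Local Notation GG := (small_set R d).
Variables (F : set (set GG)) (F_suitable : suitable F).
Variable mu : {measure set (g_sigma_algebraType F) -> \bar R}.
Hypothesis mu_translation : translation_invariant F mu.
Hypothesis mu_scale : semi_scale_invariant F mu.
Hypothesis mu_hitting : forall (A : set 'rV[R]_d) (delta : R),
  bounded_set A -> 0 < delta -> (mu (hitting A delta) < +oo)%E.
Hypothesis mu_fat_boundary : mu (@fat_boundary R d) = 0%E.

Let a := fine (mu (@calA1 R d)).

(** The mass of [calA1] lies between those of the containing and of the hitting sets, whose
    difference tends to 0. *)
Lemma small_radius (e : R) : 0 < e -> exists r, [/\ 0 < r, r <= 1,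
  fine (mu (hit (cube 0 r) 0)) < a + e &
  a - e < fine (mu (cont (cube 0 r) 0))].
Proof.
move=> e0; have ca := mu_straddle_cvg0 F_suitable mu_translation mu_scale
  mu_hitting mu_fat_boundary.
have /fine_cvgP[_ /cvgrPdist_lt/(_ _ e0)[n _ nP]] := ca.
have := nP n (leqnn _) => /=; set r : R := 2^-1 / n.+1%:R => nr.
have r0 : 0 < r by rewrite divr_gt0.
exists r; split=> //.
- by rewrite ler_pdivrMr// mul1r (@le_trans _ _ 1) ?ler1n//; lra.
all: move: nr; rewrite /= sub0r normrN => /(le_lt_trans (ler_norm _)).
all: have hf : mu (hit (cube 0 r) 0) \is a fin_num by
  rewrite ge0_fin_numE//; apply: mu_hit_fin => //; exact: cube_bounded.
all: have cf : mu (cont (cube 0 r) 0) \is a fin_num by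
  rewrite ge0_fin_numE//; apply: mu_cont_fin => //; exact: ltW.
all: have af : mu (@calA1 R d) \is a fin_num by
  rewrite ge0_fin_numE//; exact: mu_calA1_fin.
all: have ah : a <= fine (mu (hit (cube 0 r) 0)) by
  apply: fine_le => //; apply: le_measure; rewrite ?inE;
  [exact: measurable_calA1|apply: measurable_hit => //; exact: cube_bounded|
   apply: calA1_sub_hit; exact: ltW].
all: have ac : fine (mu (cont (cube 0 r) 0)) <= a by
  apply: fine_le => //; apply: le_measure; rewrite ?inE;
  [apply: measurable_cont => //; exact: cube_compact|exact: measurable_calA1|
   apply: cont_sub_calA1; exact: ltW].
all: rewrite fineB// => hc; lra.
Qed.

Variables (dO : measure_display) (Omega : measurableType dO).
Variables (P : probability Omega R) (Phi : Omega -> configuration R d) (l : R).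
Hypothesis l_gt0 : 0 < l.
Hypothesis Phi_poisson : poisson_process F (fun D => (l%:E * mu D)%E) P Phi.
Let covered := [set o | uncovered (Phi o) = set0].
Hypothesis measurable_covered : measurable covered.

Lemma prob_covered_supercritical : d%:R * ln 2 < l * a -> P covered = 1%E.
Proof.
(* This is the [e] for which a - e = d log 2 / l. *)
move=> la; have e0 : 0 < a - d%:R * ln 2 / l.
  by rewrite subr_gt0 ltr_pdivrMr// [a * l]mulrC.
have [r [r0 _ _ cr]] := small_radius e0.
have lr : d%:R * ln 2 < l * fine (mu (cont (cube 0 r) 0)).
  rewrite -ltr_pdivrMl//; move: cr; rewrite subKr mulrC.
  by [].
have nc := uncovered_negligible F_suitable mu_translation mu_scale mu_hitting
  l_gt0 Phi_poisson r0 lr.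
have PC : P (~` covered) = 0%E.
  apply: measure_negligible; first exact: measurableC.
  by apply: negligibleS nc => o /= oc; apply/set0P/eqP.
rewrite -[covered]setCK probability_setC ?PC ?sube0//; exact: measurableC.
Qed.

Lemma prob_covered_subcritical : l * a < d%:R * ln 2 -> P covered <> 1%E.
Proof.
(* This is the [e] for which a + e = d log 2 / l. *)
move=> la P1; have e0 : 0 < d%:R * ln 2 / l - a.
  by rewrite subr_gt0 ltr_pdivlMr// [a * l]mulrC.
have [r [r0 r1 hr _]] := small_radius e0.
set h := fine (mu (hit (cube 0 r) 0)) in hr.
have lh : l * h < d%:R * ln 2.
  by rewrite -ltr_pdivlMl// [ltRHS]mulrC; move: hr; rewrite addrC subrK.
(* [th] is exp(l h) / 2^d, below 1; with its fourth root as [s], the energy condition on exp(l h) is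
   an equality. *)
pose th := expR (l * h - d%:R * ln 2); pose s := Num.sqrt (Num.sqrt th).
have th0 : 0 < th by exact: expR_gt0.
have s0 : 0 < s by rewrite !sqrtr_gt0.
have s4 : s ^+ 4 = th.
  by rewrite (exprM s 2 2) !sqr_sqrtr// ?sqrtr_ge0// ltW.
have s1 : s < 1.
  have th1 : th < 1 by rewrite -expR0 ltr_expR subr_lt0.
  rewrite ltNge; apply/negP => s1; move: th1; rewrite -s4 ltNge.
  by rewrite exprn_ege1.
have ws : expR (l * h) <= 2 ^+ d * s ^+ 4.
  by rewrite s4 /th expRD expRN expRM_natl lnK ?posrE// mulrCA divff ?mulr1.
have vs : s ^- 2 * s ^+ 2 = 1 by rewrite mulVf// expf_neq0// gt_eqF.
have pos := limsup_charged_gt0 F_suitable mu_translation mu_scale mu_hitting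
  l_gt0 Phi_poisson r1 s0 s1 ws vs.
have := probability_setC P measurable_covered; rewrite P1 subee// => PC.
have mE n : measurable (charged mu Phi l r (s ^- 2) s n).
  by apply: (prob_charged F_suitable mu_translation mu_scale mu_hitting
    l_gt0 Phi_poisson r1 s0 s1 ws vs n).1.
have : (P (lim_sup_set (charged mu Phi l r (s ^- 2) s)) <= P (~` covered))%E.
  apply: le_measure; rewrite ?inE.
  - by apply: bigcap_measurable => // n _; apply: bigcup_measurable.
  - exact: measurableC.
  - move=> o /(charged_uncovered r0 s0 s1 vs) /set0P/eqP.
    by [].
by rewrite PC leNgt pos.
Qed.

End critical.

Theorem theorem1p1 (R : realType) (d : nat) (d_gt0 : (0 < d)%N)
  (F : set (set (small_set R d))) (F_suitable : suitable F)
  (mu : {measure set (g_sigma_algebraType F) -> \bar R})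
  (mu_infinite : mu setT = +oo%E)
  (mu_translation : translation_invariant F mu)
  (mu_scale : semi_scale_invariant F mu)
  (mu_hitting : forall (A : set 'rV[R]_d) (delta : R),
     bounded_set A -> 0 < delta -> (mu (hitting A delta) < +oo)%E)
  (mu_fat_boundary : mu (@fat_boundary R d) = 0%E)
  (mu_fat : (0 < mu (@fat R d))%E)
  (dO : measure_display) (Omega : R -> measurableType dO)
  (P : forall l : R, probability (Omega l) R)
  (Phi : forall l : R, Omega l -> configuration R d)
  (Phi_poisson : forall l : R, 0 < l ->
     poisson_process F (fun D => (l%:E * mu D)%E) (P l) (Phi l))
  (empty_measurable : forall l : R, 0 < l ->
     measurable [set w : Omega l | uncovered (Phi l w) = set0]) :
  lambda_e P Phi = ((d%:R * ln 2)%:E / mu (@calA1 R d))%E.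
Proof.
have A0 := mu_calA1_gt0 F_suitable mu_translation mu_scale mu_hitting
  mu_fat_boundary d_gt0 mu_fat.
have Afin := mu_calA1_fin F_suitable mu_hitting.
have af : mu (@calA1 R d) \is a fin_num by rewrite ge0_fin_numE.
set a := fine (mu (@calA1 R d)).
have a0 : 0 < a by rewrite fine_gt0// A0.
have muA : mu (@calA1 R d) = a%:E by rewrite fineK.
rewrite muA inver gt_eqF// -EFinM; apply/eqP; rewrite eq_le; apply/andP; split.
  (* Nothing is claimed at the critical value itself, so it is approached from above. *)
  apply/lee_addgt0Pr => e e0; apply: ereal_inf_lbound.
  have l0 : 0 < d%:R * ln 2 / a + e.
    by rewrite ltr_wpDl// divr_ge0 ?mulr_ge0 ?ln_ge0 ?ler1n// ltW.
  exists (d%:R * ln 2 / a + e) => //; split=> //.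
  apply: (prob_covered_supercritical F_suitable mu_translation mu_scale
    mu_hitting mu_fat_boundary l0 (Phi_poisson _ l0) (empty_measurable _ l0)).
  by rewrite -/a mulrDl divfK ?gt_eqF// ltrDl mulr_gt0.
apply: le_ereal_inf_tmp => _ [l [l0 Pl] <-]; rewrite lee_fin leNgt; apply/negP.
rewrite ltr_pdivlMr// => la; move: Pl.
exact: (prob_covered_subcritical F_suitable mu_translation mu_scale
  mu_hitting mu_fat_boundary l0 (Phi_poisson _ l0) (empty_measurable _ l0) la).
Qed.
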